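(* Let $\mathfrak g$ be a finite-dimensional complex simple Lie algebra of rank $l$, $\pi\in S_l$, $s_\pi$ the corresponding Coxeter element and $c_{ij}^\pi=\big(\frac{1+s_\pi}{1-s_\pi}\alpha_i,\alpha_j\big)$. For every solution $n_{ij}\in\mathbb C$, $i,j=1,\dots,l$, of the equations $$d_jn_{ij}-d_in_{ji}=c_{ij}^\pi$$ there exists an algebra isomorphism $\psi_{\{n\}}:U_h^{s_\pi}(\mathfrak g)\to U_h(\mathfrak g)$ defined by the formulas $$\psi_{\{n\}}(e_i)=X_i^+\prod_{p=1}^lL_p^{n_{ip}},\qquad \psi_{\{n\}}(f_i)=\prod_{p=1}^lL_p^{-n_{ip}}X_i^-,\qquad \psi_{\{n\}}(H_i)=H_i .$$
   Context: All $\mathbb C[[h]]$-algebras are topological ($h$-adic topology, topologically generated by the given generators). $\mathfrak g$ has simple roots $\alpha_1,\dots,\alpha_l$, Cartan matrix $a_{ij}$; $d_1,\dots,d_l$ are coprime positive integers such that $b_{ij}=d_ia_{ij}$ is symmetric; $(\alpha_i,\alpha_j)=b_{ij}$ is the corresponding Weyl-group-invariant form on $\mathfrak h^*$; $s_1,\dots,s_l$ are the simple reflections, and $s_\pi=s_{\pi(1)}\cdots s_{\pi(l)}$. Put $q=e^h$, $q_i=e^{d_ih}$, $\left[{m\atop n}\right]_q=\frac{[m]_q!}{[n]_q![m-n]_q!}$, $[n]_q=\frac{q^n-q^{-n}}{q-q^{-1}}$. The standard quantum group $U_h(\mathfrak g)$ is the $\mathbb C[[h]]$-algebra topologically generated by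 $H_i,X_i^\pm$, $i=1,\dots,l$, with relations $[H_i,H_j]=0$, $[H_i,X_j^\pm]=\pm a_{ij}X_j^\pm$, $X_i^+X_j^--X_j^-X_i^+=\delta_{ij}\frac{K_i-K_i^{-1}}{q_i-q_i^{-1}}$ with $K_i=e^{d_ihH_i}$, and $\sum_{r=0}^{1-a_{ij}}(-1)^r\left[{1-a_{ij}\atop r}\right]_{q_i}(X_i^\pm)^{1-a_{ij}-r}X_j^\pm(X_i^\pm)^r=0$ for $i\neq j$. Put $Y_i=\sum_{j=1}^ld_i(a^{-1})_{ij}H_j$ and $L_i=e^{hY_i}$ (so $L_iX_j^\pm L_i^{-1}=q_i^{\pm\delta_{ij}}X_j^\pm$), and $L_i^{c}=e^{chY_i}$ for $c\in\mathbb C$. $U_h^{s_\pi}(\mathfrak g)$ is the $\mathbb C[[h]]$-algebra topologically generated by $e_i,f_i,H_i$, $i=1,\dots,l$, with relations $[H_i,H_j]=0$, $[H_i,e_j]=a_{ij}e_j$, $[H_i,f_j]=-a_{ij}f_j$, $$e_if_j-q^{-c_{ij}^\pi}f_je_i=\delta_{ij}\frac{K_i-K_i^{-1}}{q_i-q_i^{-1}},\qquad K_i=e^{d_ihH_i},$$ $$\sum_{r=0}^{1-a_{ij}}(-1)^rq^{rc_{ij}^\pi}\left[{1-a_{ij}\atop r}\right]_{q_i}e_i^{1-a_{ij}-r}e_je_i^r=0,\qquad \sum_{r=0}^{1-a_{ij}}(-1)^rq^{rc_{ij}^\pi}\left[{1-a_{ij}\atop r}\right]_{q_i}f_i^{1-a_{ij}-r}f_jf_i^r=0\quad(i\ne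 j).$$ *)

(* Defs.v *)
From HB Require Import structures.
From mathcomp Require Import all_boot all_order all_fingroup all_algebra.
From mathcomp Require Import boolp reals complex.
From mathcomp Require Import finmap monalg zify generic_quotient.

Set Implicit Arguments.
Unset Strict Implicit.
Unset Printing Implicit Defensive.

Import GRing.Theory.
Local Open Scope ring_scope.

(** [fps A] is A[[h]] with h central; [f n] is the coefficient of h^n. *)

Record fps (A : Type) := FPS { fps_coef :> nat -> A }.

HB.instance Definition _ (A : Type) := gen_eqMixin (fps A).
HB.instance Definition _ (A : Type) := gen_choiceMixin (fps A).

Lemma fpsP (A : Type) (f g : fps A) : (forall n, f n = g n) -> f = g.
Proof. by case: f g => [f] [g] /= /funext ->. Qed.

Section FpsZmod.
Variable A : zmodType.
Implicit Types f g : fps A.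

Definition fps_zero : fps A := FPS (fun=> 0).
Definition fps_opp f : fps A := FPS (fun n => - f n).
Definition fps_add f g : fps A := FPS (fun n => f n + g n).

Fact fps_addA : associative fps_add.
Proof. by move=> f g k; apply: fpsP => n /=; rewrite addrA. Qed.
Fact fps_addC : commutative fps_add.
Proof. by move=> f g; apply: fpsP => n /=; rewrite addrC. Qed.
Fact fps_add0 : left_id fps_zero fps_add.
Proof. by move=> f; apply: fpsP => n /=; rewrite add0r. Qed.
Fact fps_addN : left_inverse fps_zero fps_opp fps_add.
Proof. by move=> f; apply: fpsP => n /=; rewrite addNr. Qed.

HB.instance Definition _ :=
  GRing.isZmodule.Build (fps A) fps_addA fps_addC fps_add0 fps_addN.

Lemma coefh0 n : (0 : fps A) n = 0. Proof. by []. Qed.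
Lemma coefhN f n : (- f) n = - f n. Proof. by []. Qed.
Lemma coefhD f g n : (f + g) n = f n + g n. Proof. by []. Qed.
Lemma coefhB f g n : (f - g) n = f n - g n. Proof. by []. Qed.
Lemma coefh_sum I (r : seq I) (P : pred I) (F : I -> fps A) n :
  (\sum_(i <- r | P i) F i) n = \sum_(i <- r | P i) F i n.
Proof. by elim/big_rec2: _ => //= i y x _ <-. Qed.

End FpsZmod.

(** Cauchy products with respect to an arbitrary bilinear operation; this
    covers both the product of A[[h]] and the action of K[[h]] on it. *)
Section Convolution.
Variables (U V W : zmodType) (op : U -> V -> W).

Definition conv (f : fps U) (g : fps V) : fps W :=
  FPS (fun n => \sum_(i < n.+1) op (f i) (g (n - i)%N)).

Hypothesis opDl : forall u v w, op (u + v) w = op u w + op v w.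
Hypothesis opDr : forall u v w, op u (v + w) = op u v + op u w.

Lemma convDl f g k : conv (f + g) k = conv f k + conv g k.
Proof.
by apply: fpsP => n /=; rewrite -big_split; apply: eq_bigr => i _; rewrite opDl.
Qed.

Lemma convDr f g k : conv f (g + k) = conv f g + conv f k.
Proof.
by apply: fpsP => n /=; rewrite -big_split; apply: eq_bigr => i _; rewrite opDr.
Qed.

End Convolution.

Lemma conv_rev (U V W : zmodType) (op : U -> V -> W) f g n :
  conv op f g n = \sum_(i < n.+1) op (f (n - i)%N) (g i).
Proof.
rewrite /= (reindex_inj rev_ord_inj) /=.
by apply: eq_bigr => i _; rewrite (sub_ordK i) subSS.
Qed.

Section ConvAssoc.
Variables (U V W UV VW T : zmodType).
Variables (op1 : U -> V -> UV) (op2 : UV -> W -> T).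
Variables (op3 : V -> W -> VW) (op4 : U -> VW -> T).
Hypothesis op2D : forall w u v, op2 (u + v) w = op2 u w + op2 v w.
Hypothesis op20 : forall w, op2 0 w = 0.
Hypothesis op4D : forall u v w, op4 u (v + w) = op4 u v + op4 u w.
Hypothesis op40 : forall u, op4 u 0 = 0.
Hypothesis opA : forall u v w, op4 u (op3 v w) = op2 (op1 u v) w.

Lemma convA f g k : conv op4 f (conv op3 g k) = conv op2 (conv op1 f g) k.
Proof.
apply: fpsP => n; rewrite [RHS]conv_rev.
pose t i j := op4 (f i) (op3 (g (n - i - j)%N) (k j)).
transitivity (\sum_(i < n.+1) \sum_(j < n.+1 | (j <= n - i)%N) t i j).
  apply: eq_bigr => i _; rewrite conv_rev.
  rewrite (big_morph (op4 (f i)) (op4D (f i)) (op40 (f i))).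
  by rewrite (big_ord_narrow_leq (leq_subr _ _)).
rewrite (exchange_big_dep predT) //=; apply: eq_bigr => j _.
transitivity (\sum_(i < n.+1 | (i <= n - j)%N) t i j).
  apply: eq_bigl => i; rewrite -ltnS -(ltnS i) -!subSn ?leq_ord //.
  by rewrite -subn_gt0 -(subn_gt0 i) -!subnDA addnC.
rewrite (big_ord_narrow_leq (leq_subr _ _)).
rewrite (big_morph (op2^~ (k j)) (op2D (k j)) (op20 (k j))).
by apply: eq_bigr => i _; rewrite /t -!subnDA addnC opA.
Qed.

End ConvAssoc.

Definition fpsC (A : zmodType) (a : A) : fps A :=
  FPS (fun n => if n == 0 then a else 0).

Lemma conv_fpsCl (U V W : zmodType) (op : U -> V -> W) u g n :
  (forall v, op 0 v = 0) -> conv op (fpsC u) g n = op u (g n).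
Proof.
by move=> op0; rewrite /= big_ord_recl subn0 /= big1 ?addr0 // => i _; rewrite op0.
Qed.

Lemma conv_fpsCr (U V W : zmodType) (op : U -> V -> W) f v n :
  (forall u, op u 0 = 0) -> conv op f (fpsC v) n = op (f n) v.
Proof.
by move=> op0; rewrite conv_rev big_ord_recl subn0 /= big1 ?addr0.
Qed.

Section FpsRing.
Variable A : nzRingType.

Definition fps_mul : fps A -> fps A -> fps A := conv *%R.

Fact fps_mulA : associative fps_mul.
Proof.
move=> f g k; apply: convA => *;
  rewrite ?(mulrDl, mul0r, mulrDr, mulr0, mulrA) //.
Qed.
Fact fps_mul1l : left_id (fpsC 1) fps_mul.
Proof. by move=> f; apply: fpsP => n; rewrite conv_fpsCl ?mul1r // => v; exact: mul0r. Qed.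
Fact fps_mul1r : right_id (fpsC 1) fps_mul.
Proof. by move=> f; apply: fpsP => n; rewrite conv_fpsCr ?mulr1 // => v; exact: mulr0. Qed.
Fact fps_mulDl : left_distributive fps_mul +%R.
Proof. by move=> f g k; apply: convDl => u v w; exact: mulrDl. Qed.
Fact fps_mulDr : right_distributive fps_mul +%R.
Proof. by move=> f g k; apply: convDr => u v w; exact: mulrDr. Qed.
Fact fps_oner_neq0 : fpsC 1 != 0 :> fps A.
Proof.
apply/eqP => /(congr1 (fun f : fps A => f 0%N)) /eqP.
by rewrite coefh0 (negPf (oner_neq0 A)).
Qed.

HB.instance Definition _ := GRing.Zmodule_isNzRing.Build (fps A)
  fps_mulA fps_mul1l fps_mul1r fps_mulDl fps_mulDr fps_oner_neq0.

Lemma coefhM (f g : fps A) n : (f * g) n = \sum_(i < n.+1) f i * g (n - i)%N.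
Proof. by []. Qed.
Lemma coefh1 n : (1 : fps A) n = if n == 0 then 1 else 0.
Proof. by []. Qed.

End FpsRing.

Section FpsComRing.
Variable A : comNzRingType.

Fact fps_mulC : commutative (@fps_mul A).
Proof.
move=> f g; apply: fpsP => n; rewrite /fps_mul conv_rev.
by apply: eq_bigr => i _; rewrite mulrC.
Qed.

HB.instance Definition _ := GRing.PzRing_hasCommutativeMul.Build (fps A) fps_mulC.

End FpsComRing.

Section FpsAlgebra.
Variables (K : comNzRingType) (A : algType K).

Definition fps_scale : fps K -> fps A -> fps A := conv *:%R.

Fact fps_scaleA f g (k : fps A) : fps_scale f (fps_scale g k) = fps_scale (f * g) k.
Proof.
apply: convA => *; rewrite ?(scalerDl, scale0r, scalerDr, scaler0, scalerA) //.
Qed.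
Fact fps_scale1 : left_id 1 fps_scale.
Proof.
by move=> f; apply: fpsP => n; rewrite conv_fpsCl ?scale1r // => v; exact: scale0r.
Qed.
Fact fps_scaleDr : right_distributive fps_scale +%R.
Proof. by move=> f g k; apply: convDr => u v w; exact: scalerDr. Qed.
Fact fps_scaleDl k : {morph fps_scale^~ k : f g / f + g}.
Proof. by move=> f g; apply: convDl => u v w; exact: scalerDl. Qed.

HB.instance Definition _ := GRing.Zmodule_isLmodule.Build (fps K) (fps A)
  fps_scaleA fps_scale1 fps_scaleDr fps_scaleDl.

Fact fps_scalerAl (f : fps K) (g k : fps A) : f *: (g * k) = (f *: g) * k.
Proof.
apply: convA => *; rewrite ?(mulrDl, mul0r, scalerDr, scaler0, scalerAl) //.
Qed.

HB.instance Definition _ :=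
  GRing.Lmodule_isLalgebra.Build (fps K) (fps A) fps_scalerAl.

Fact fps_scalerAr (f : fps K) (g k : fps A) : f *: (g * k) = g * (f *: k).
Proof.
have scC (u : fps A) : f *: u = conv (fun (x : A) c => c *: x) u f.
  by apply: fpsP => n; rewrite conv_rev.
have -> : f *: k = conv (fun (x : A) c => c *: x) k f by exact: scC.
rewrite scC; symmetry; apply: convA => *; rewrite ?(scalerDr, scaler0, mulrDr, mulr0, scalerAr) //.
Qed.

HB.instance Definition _ :=
  GRing.Lalgebra_isAlgebra.Build (fps K) (fps A) fps_scalerAr.

End FpsAlgebra.

Section FpsInverse.
Variable K : fieldType.
Implicit Types f g : fps K.

Definition fps_unit : pred (fps K) := fun f => f 0%N != 0.

(** The inverse of f = f_0 (1 - u) with u_0 = 0 is f_0^-1 (1 + u + u^2 + ...),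
    where u^k does not contribute to the coefficient of h^n when k > n. *)
Definition fps_geom f : fps K :=
  FPS (fun n => (f 0%N)^-1 *
         (\sum_(k < n.+1) (1 - fpsC (f 0%N)^-1 * f) ^+ k) n).
Definition fps_inv f : fps K := if fps_unit f then fps_geom f else f.

Lemma coefhX_gt f k n : f 0%N = 0 -> (n < k)%N -> (f ^+ k) n = 0.
Proof.
move=> f0; elim: k n => // k IHk n ltnk; rewrite exprS coefhM big1 // => -[i /= ltin] _.
by case: i ltin => [|i] ltin; [rewrite f0 mul0r | rewrite IHk ?mulr0 //; lia].
Qed.

Fact fps_mulVf : {in fps_unit, left_inverse 1 fps_inv *%R}.
Proof.
move=> f; rewrite unfold_in => f0; rewrite /fps_inv /fps_unit f0.
pose c := fpsC (f 0%N)^-1; pose u := 1 - c * f.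
have cE g n : (c * g) n = (f 0%N)^-1 * g n.
  by rewrite /c -[LHS]/(conv _ _ _ _) conv_fpsCl // => v; exact: mul0r.
have u0 : u 0%N = 0 by rewrite coefhB cE mulVf // subrr.
apply: fpsP => n; pose S m := \sum_(k < m.+1) u ^+ k.
have trunc i : (i <= n)%N -> (S n) i = (S i) i.
  move=> le_in; rewrite /S -!(big_mkord xpredT (fun k => u ^+ k)).
  rewrite (big_cat_nat (n := i.+1)) // coefhD [X in _ + X = _]coefh_sum.
  rewrite [X in _ + X = _]big_nat [X in _ + X = _]big1 ?addr0 // => k /andP[ik _].
  by rewrite coefhX_gt.
transitivity ((c * S n * f) n).
  rewrite !coefhM; apply: eq_bigr => i _; congr (_ * _).
  by rewrite cE trunc // -ltnS.
have -> : c * S n * f = 1 - u ^+ n.+1.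
  have -> : c * S n * f = (1 - u) * S n by rewrite opprB addrC subrK mulrAC.
  by rewrite -[RHS]opprB subrX1 -mulNr [- (u - 1)]opprB.
by rewrite coefhB (coefhX_gt u0) // subr0.
Qed.

Fact fps_unitP f g : g * f = 1 -> fps_unit f.
Proof.
move=> /(congr1 (fun k : fps K => k 0%N)); rewrite coefhM big_ord1 coefh1 /= => gf.
by apply/eqP => f0; move: gf; rewrite f0 mulr0 => /esym/eqP; rewrite oner_eq0.
Qed.

Fact fps_inv_out : {in [predC fps_unit], fps_inv =1 id}.
Proof.
move=> f; rewrite !inE /fps_inv; case: ifP => // fu.
by rewrite -topredE /= fu.
Qed.

HB.instance Definition _ :=
  GRing.ComNzRing_hasMulInverse.Build (fps K) fps_mulVf fps_unitP fps_inv_out.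

End FpsInverse.

Definition hvar (A : nzRingType) : fps A := FPS (fun n => if n == 1 then 1 else 0).

Definition fps_tl (A : Type) (f : fps A) : fps A := FPS (fun n => f n.+1).

Section HExponential.
Variables (K : fieldType) (A : algType K).

(** e^(ha) for a in A. *)
Definition hexp (a : A) : fps A := FPS (fun n => n`!%:R^-1 *: a ^+ n).

(** The quotient f/g when f and g are both divisible by h and g/h is
    invertible: h is cancelled first, as in (K - K^-1)/(q - q^-1). *)
Definition hdiv (f : fps A) (g : fps K) : fps A := (fps_tl g)^-1 *: fps_tl f.

Lemma hvar_tl (g : fps K) : g 0%N = 0 -> g = hvar K * fps_tl g.
Proof.
move=> g0; apply: fpsP => -[|n]; first by rewrite coefhM big_ord1 /= mul0r.
rewrite coefhM big_ord_recl /= mul0r add0r big_ord_recl /= mul1r big1 ?addr0 //.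
  by rewrite subSS subn0.
by move=> i _; rewrite mul0r.
Qed.

Lemma hvar_tl_scale (f : fps A) : f 0%N = 0 -> f = hvar K *: fps_tl f.
Proof.
move=> f0; apply: fpsP => -[|n]; first by rewrite /= big_ord1 /= scale0r.
rewrite /= big_ord_recl /= scale0r add0r big_ord_recl /= scale1r big1 ?addr0 //.
  by rewrite subSS subn0.
by move=> i _; rewrite scale0r.
Qed.

Lemma hdivK (f : fps A) (g : fps K) :
  f 0%N = 0 -> g 0%N = 0 -> g 1%N != 0 -> g *: hdiv f g = f.
Proof.
move=> f0 g0 g1; rewrite {1}(hvar_tl g0) /hdiv scalerA -mulrA divrr ?mulr1 -?hvar_tl_scale //.
Qed.

End HExponential.

Section QNumbers.
Variable K : fieldType.

(** q^c = e^(ch). *)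
Definition qpow (c : K) : fps K := FPS (fun n => c ^+ n / n`!%:R).

(** [n]_q = (q^n - q^-n)/(q - q^-1), where h is cancelled before dividing. *)
Definition qint (q : fps K) (n : nat) : fps K :=
  fps_tl (q ^+ n - q ^- n) / fps_tl (q - q^-1).

Definition qfact (q : fps K) (n : nat) : fps K := \prod_(1 <= k < n.+1) qint q k.

Definition qbinom (q : fps K) (m n : nat) : fps K :=
  qfact q m / (qfact q n * qfact q (m - n)).

End QNumbers.

Definition free_alg (K : comNzRingType) (I : choiceType) := {malg K[{fmonom I}]}.

Section FreeAlg.
Variables (K : comNzRingType) (I : choiceType).

HB.instance Definition _ := GRing.Lalgebra.on (free_alg K I).

Fact free_alg_scalerAr (c : K) (x y : free_alg K I) : c *: (x * y) = x * (c *: y).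
Proof.
apply/malgP => k; rewrite mcoeffZ mcoeffMl.
rewrite (mcoeffMlw _ (fsubset_refl _) (msuppZ_le c y)) mulr_sumr.
apply: eq_bigr => k1 _; rewrite mulr_sumr; apply: eq_bigr => k2 _.
by rewrite mcoeffZ mulrnAr mulrCA.
Qed.

HB.instance Definition _ :=
  GRing.Lalgebra_isAlgebra.Build K (free_alg K I) free_alg_scalerAr.

Definition free_gen (i : I) : free_alg K I := << fmu i >>.

End FreeAlg.

(** [presented S] is the K[[h]]-algebra with the h-adic topology generated
    topologically by the generators of F subject to the relations r = 0,
    r in S, where F is a completed free algebra: the quotient of F by the
    smallest h-adically closed two-sided ideal containing S.  Any K[[h]]-linear
    map between such quotients is h-adically continuous, so the topology need
    not be mentioned when speaking of morphisms. *)
Section Presentation.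
Variables (K : comNzRingType) (F : algType (fps K)) (S : F -> Prop).

Definition closed_ideal (J : F -> Prop) : Prop :=
  [/\ J 0,
      forall x y, J x -> J y -> J (x + y),
      forall u x, J x -> J (u * x),
      forall u x, J x -> J (x * u)
    & forall x, (forall n, exists z, J (x - hvar K ^+ n *: z)) -> J x].

Definition rel_ideal : {pred F} := fun x =>
  `[< forall J, closed_ideal J -> (forall r, S r -> J r) -> J x >].

Lemma rel_idealP x :
  reflect (forall J, closed_ideal J -> (forall r, S r -> J r) -> J x)
          (x \in rel_ideal).
Proof. exact: asboolP. Qed.

Lemma rel_idealMl u x : x \in rel_ideal -> u * x \in rel_ideal.
Proof.
move=> /rel_idealP Ix; apply/rel_idealP => J JI JS.
by have [_ _ Jl _ _] := JI; apply: Jl; exact: Ix JI JS.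
Qed.

Lemma rel_idealMr u x : x \in rel_ideal -> x * u \in rel_ideal.
Proof.
move=> /rel_idealP Ix; apply/rel_idealP => J JI JS.
by have [_ _ _ Jr _] := JI; apply: Jr; exact: Ix JI JS.
Qed.

Fact rel_ideal_zmod : zmod_closed rel_ideal.
Proof.
split=> [|x y Ix Iy]; apply/rel_idealP => J JI JS; have [J0 JD Jl _ _] := JI => //.
apply: JD; first exact: (rel_idealP _ Ix) JI JS.
by rewrite -mulN1r; apply: Jl; exact: (rel_idealP _ Iy) JI JS.
Qed.

HB.instance Definition _ := GRing.isZmodClosed.Build F rel_ideal rel_ideal_zmod.

Definition presented := Quotient.quot rel_ideal.

HB.instance Definition _ := GRing.Zmodule.on presented.

Definition pr (x : F) : presented := \pi_presented%qT x.

Definition pr_mul (x y : presented) : presented := pr (repr x * repr y).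
Definition pr_scale (c : fps K) (x : presented) : presented := pr (c *: repr x).

Lemma pr_eq x y : (pr x = pr y) <-> x - y \in rel_ideal.
Proof. by rewrite Quotient.idealrBE; split=> [/eqP|/eqP]. Qed.

Lemma prK x : pr (repr x) = x. Proof. exact: reprK. Qed.

Lemma pr_surj x : exists y, x = pr y. Proof. by exists (repr x); rewrite prK. Qed.

Fact pr_zmod_morphism : zmod_morphism pr.
Proof. exact: (raddfB \pi_(Quotient.quot rel_ideal)%qT). Qed.

HB.instance Definition _ :=
  GRing.isZmodMorphism.Build F presented pr pr_zmod_morphism.

Lemma pr_mulE x y : pr_mul (pr x) (pr y) = pr (x * y).
Proof.
have Ex : repr (pr x) - x \in rel_ideal by apply/pr_eq; rewrite prK.
have Ey : repr (pr y) - y \in rel_ideal by apply/pr_eq; rewrite prK.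
apply/pr_eq.
have -> : repr (pr x) * repr (pr y) - x * y =
    (repr (pr x) - x) * repr (pr y) + x * (repr (pr y) - y).
  by rewrite mulrBl mulrBr addrA subrK.
by apply: rpredD; [exact: rel_idealMr | exact: rel_idealMl].
Qed.

Lemma pr_scaleE c x : pr_scale c (pr x) = pr (c *: x).
Proof.
apply/pr_eq; rewrite -scalerBr -mulr_algl; apply: rel_idealMl.
by apply/pr_eq; rewrite prK.
Qed.

Fact pr_mulA : associative pr_mul.
Proof.
move=> x y z; have [[x' ->] [[y' ->] [z' ->]]] := (pr_surj x, (pr_surj y, pr_surj z)).
by rewrite !pr_mulE mulrA.
Qed.
Fact pr_mul1l : left_id (pr 1) pr_mul.
Proof. by move=> x; have [x' ->] := pr_surj x; rewrite pr_mulE mul1r. Qed.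
Fact pr_mul1r : right_id (pr 1) pr_mul.
Proof. by move=> x; have [x' ->] := pr_surj x; rewrite pr_mulE mulr1. Qed.
Fact pr_mulDl : left_distributive pr_mul +%R.
Proof.
move=> x y z; have [[x' ->] [[y' ->] [z' ->]]] := (pr_surj x, (pr_surj y, pr_surj z)).
by rewrite -raddfD !pr_mulE mulrDl raddfD.
Qed.
Fact pr_mulDr : right_distributive pr_mul +%R.
Proof.
move=> x y z; have [[x' ->] [[y' ->] [z' ->]]] := (pr_surj x, (pr_surj y, pr_surj z)).
by rewrite -raddfD !pr_mulE mulrDr raddfD.
Qed.

HB.instance Definition _ := GRing.Zmodule_isPzRing.Build presented
  pr_mulA pr_mul1l pr_mul1r pr_mulDl pr_mulDr.

Fact pr_scaleA c e x : pr_scale c (pr_scale e x) = pr_scale (c * e) x.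
Proof. by have [x' ->] := pr_surj x; rewrite !pr_scaleE scalerA. Qed.
Fact pr_scale1 : left_id 1 pr_scale.
Proof. by move=> x; have [x' ->] := pr_surj x; rewrite pr_scaleE scale1r. Qed.
Fact pr_scaleDr : right_distributive pr_scale +%R.
Proof.
move=> c x y; have [[x' ->] [y' ->]] := (pr_surj x, pr_surj y).
by rewrite -raddfD !pr_scaleE scalerDr raddfD.
Qed.
Fact pr_scaleDl x : {morph pr_scale^~ x : c e / c + e}.
Proof.
by move=> c e; have [x' ->] := pr_surj x; rewrite !pr_scaleE scalerDl raddfD.
Qed.

HB.instance Definition _ := GRing.Zmodule_isLmodule.Build (fps K) presented
  pr_scaleA pr_scale1 pr_scaleDr pr_scaleDl.

(** The structures lalgType and algType require 1 != 0, which may fail for an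
    arbitrary S; so [presented] is declared as a pzRingType and an lmodType, and
    the two compatibility axioms of an algebra are stated separately. *)
Lemma presented_scalerAl (c : fps K) (x y : presented) : c *: (x * y) = (c *: x) * y.
Proof.
have [[x' ->] [y' ->]] := (pr_surj x, pr_surj y).
rewrite [pr x' * _]pr_mulE [LHS]pr_scaleE [c *: pr x']pr_scaleE [RHS]pr_mulE.
by rewrite scalerAl.
Qed.

Lemma presented_scalerAr (c : fps K) (x y : presented) : c *: (x * y) = x * (c *: y).
Proof.
have [[x' ->] [y' ->]] := (pr_surj x, pr_surj y).
rewrite [pr x' * _]pr_mulE [LHS]pr_scaleE [c *: pr y']pr_scaleE [RHS]pr_mulE.
by rewrite scalerAr.
Qed.

Fact pr_monoid_morphism : monoid_morphism pr.
Proof. by split=> // x y; rewrite -pr_mulE. Qed.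
Fact pr_scalable : scalable pr.
Proof. by move=> c x; rewrite -pr_scaleE. Qed.

HB.instance Definition _ :=
  GRing.isMonoidMorphism.Build F presented pr pr_monoid_morphism.
HB.instance Definition _ :=
  GRing.isScalable.Build (fps K) F presented *:%R pr pr_scalable.

End Presentation.

Section QuantumGroups.
Variables (K : fieldType) (l : nat).

Definition gens := ('I_l + 'I_l + 'I_l)%type.

(** The completed free algebra K<H_i, x_i, y_i>[[h]]; x_i stands for X_i^+ or
    e_i, and y_i for X_i^- or f_i. *)
Definition free_gens := fps (free_alg K gens).

Definition H0 (i : 'I_l) : free_alg K gens := free_gen K (inl (inl i)).
Definition genH (i : 'I_l) : free_gens := fpsC (H0 i).
Definition genx (i : 'I_l) : free_gens := fpsC (free_gen K (inl (inr i))).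
Definition geny (i : 'I_l) : free_gens := fpsC (free_gen K (inr i)).

Variables (a : 'M[int]_l) (d : 'I_l -> nat).

Definition q_ (i : 'I_l) : fps K := qpow (d i)%:R.

(** (K_i - K_i^-1)/(q_i - q_i^-1), where K_i = e^(d_i h H_i). *)
Definition Kfrac (i : 'I_l) : free_gens :=
  hdiv (hexp ((d i)%:R *: H0 i) - hexp (- ((d i)%:R *: H0 i)))
       (q_ i - (q_ i)^-1).

(** sum_(r <= m) (-1)^r t^r [m choose r]_q x^(m-r) y x^r *)
Definition qserre (q t : fps K) (m : nat) (x y : free_gens) : free_gens :=
  \sum_(r < m.+1)
    ((-1) ^+ r * t ^+ r * qbinom q m r) *: (x ^+ (m - r) * y * x ^+ r).

(** 1 - a_ij, a natural number for i != j when a is a Cartan matrix. *)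
Definition serre_exp (i j : 'I_l) : nat := `|1 - a i j|%N.

Inductive std_rel : free_gens -> Prop :=
| std_HH i j : std_rel (genH i * genH j - genH j * genH i)
| std_HX i j :
    std_rel (genH i * genx j - genx j * genH i - (a i j)%:~R *: genx j)
| std_HY i j :
    std_rel (genH i * geny j - geny j * genH i + (a i j)%:~R *: geny j)
| std_XY i j :
    std_rel (genx i * geny j - geny j * genx i - (i == j)%:R *: Kfrac i)
| std_serreX i j of i != j :
    std_rel (qserre (q_ i) 1 (serre_exp i j) (genx i) (genx j))
| std_serreY i j of i != j :
    std_rel (qserre (q_ i) 1 (serre_exp i j) (geny i) (geny j)).

Inductive cox_rel (c : 'M[K]_l) : free_gens -> Prop :=
| cox_HH i j : cox_rel c (genH i * genH j - genH j * genH i)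
| cox_He i j :
    cox_rel c (genH i * genx j - genx j * genH i - (a i j)%:~R *: genx j)
| cox_Hf i j :
    cox_rel c (genH i * geny j - geny j * genH i + (a i j)%:~R *: geny j)
| cox_ef i j :
    cox_rel c (genx i * geny j - qpow (- c i j) *: (geny j * genx i)
               - (i == j)%:R *: Kfrac i)
| cox_serre_e i j of i != j :
    cox_rel c (qserre (q_ i) (qpow (c i j)) (serre_exp i j) (genx i) (genx j))
| cox_serre_f i j of i != j :
    cox_rel c (qserre (q_ i) (qpow (c i j)) (serre_exp i j) (geny i) (geny j)).

(** U_h(g) and U_h^s(g), for g with Cartan matrix a and symmetrizing integers
    d; the latter also depends on the matrix c attached to s. *)
Definition Uh := presented std_rel.
Definition Uhs (c : 'M[K]_l) := presented (cox_rel c).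

HB.instance Definition _ := GRing.PzRing.on Uh.
HB.instance Definition _ := GRing.Lmodule.on Uh.
HB.instance Definition _ c := GRing.PzRing.on (Uhs c).
HB.instance Definition _ c := GRing.Lmodule.on (Uhs c).

Definition Uh_H (i : 'I_l) : Uh := pr std_rel (genH i).
Definition Uh_Xp (i : 'I_l) : Uh := pr std_rel (genx i).
Definition Uh_Xm (i : 'I_l) : Uh := pr std_rel (geny i).

Definition Uhs_H c (i : 'I_l) : Uhs c := pr (cox_rel c) (genH i).
Definition Uhs_e c (i : 'I_l) : Uhs c := pr (cox_rel c) (genx i).
Definition Uhs_f c (i : 'I_l) : Uhs c := pr (cox_rel c) (geny i).

Definition Y0 (i : 'I_l) : free_alg K gens :=
  \sum_(j < l) ((d i)%:R * invmx (map_mx intr a : 'M[K]_l) i j) *: H0 j.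

(** L_i^c = e^(c h Y_i) *)
Definition Uh_L (i : 'I_l) (c : K) : Uh := pr std_rel (hexp (c *: Y0 i)).

End QuantumGroups.

Arguments Uhs_H {K l a d c} i.
Arguments Uhs_e {K l a d c} i.
Arguments Uhs_f {K l a d c} i.
Arguments Uh_H {K l a d} i.
Arguments Uh_Xp {K l a d} i.
Arguments Uh_Xm {K l a d} i.
Arguments Uh_L {K l a d} i c.

Record lieAlg (K : fieldType) := LieAlg {
  lie_sort :> vectType K;
  bracket : lie_sort -> lie_sort -> lie_sort;
  bracket_linearl : forall y, linear (bracket^~ y);
  bracket_linearr : forall x, linear (bracket x);
  bracket_alt : forall x, bracket x x = 0;
  bracket_jacobi : forall x y z,
    bracket x (bracket y z) + bracket y (bracket z x)
      + bracket z (bracket x y) = 0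
}.

Section LieTheory.
Variables (K : fieldType) (g : lieAlg K).

Definition lie_simple : Prop :=
  (exists x y : g, bracket x y <> 0) /\
  (forall I : {vspace g}, (forall x y, y \in I -> bracket x y \in I) ->
     I = 0%VS \/ I = fullv).

Definition lie_abelian (V : {vspace g}) : Prop :=
  forall x y, x \in V -> y \in V -> bracket x y = 0.

Definition ad_diagonalizable (x : g) : Prop :=
  exists e : seq g,
    basis_of fullv e /\ (forall v, v \in e -> exists c : K, bracket x v = c *: v).

(** For g semisimple: a maximal abelian subalgebra with ad-semisimple elements (over an
    algebraically closed field, semisimple means diagonalizable). *)
Definition cartan_subalgebra (h : {vspace g}) : Prop :=
  [/\ lie_abelian h,
      forall h' : {vspace g}, (h <= h')%VS -> lie_abelian h' -> h' = h
    & forall x, x \in h -> ad_diagonalizable x].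

Variable h : {vspace g}.

Definition dual := 'Hom(subvs_of h, K^o).

Definition weight_vector (alpha : dual) (x : g) : Prop :=
  forall t : subvs_of h, bracket (vsval t) x = (alpha t : K) *: x.

Definition is_root (alpha : dual) : Prop :=
  alpha <> 0 /\ (exists2 x : g, x <> 0 & weight_vector alpha x).

Definition is_simple_system (l : nat) (alpha : l.-tuple dual) : Prop :=
  [/\ forall i, is_root (tnth alpha i),
      basis_of fullv alpha
    & forall beta, is_root beta ->
        exists m : 'I_l -> nat,
          beta = \sum_i tnth alpha i *+ m i \/
          beta = - \sum_i tnth alpha i *+ m i].

(** t is the element of [g_alpha, g_-alpha] with alpha(t) = 2. *)
Definition is_coroot (alpha : dual) (t : subvs_of h) : Prop :=
  (alpha t : K) = 2%:R /\
  (exists x y : g,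
     [/\ weight_vector alpha x, weight_vector (- alpha) y & bracket x y = vsval t]).

End LieTheory.

Record root_datum (K : fieldType) (g : lieAlg K) (l : nat) := RootDatum {
  cartan : {vspace g};
  cartanP : cartan_subalgebra cartan;
  simple_root : l.-tuple (dual cartan);
  simple_rootP : is_simple_system simple_root;
  coroot : 'I_l -> subvs_of cartan;
  corootP : forall i, is_coroot (tnth simple_root i) (coroot i)
}.

Section RootDatum.
Variables (K : fieldType) (g : lieAlg K) (l : nat) (D : root_datum g l).
Variables (a : 'M[int]_l) (d : 'I_l -> nat).

Definition is_cartan_matrix : Prop :=
  forall i j, (tnth (simple_root D) j (coroot D i) : K) = (a i j)%:~R.

(** The bilinear form on the dual of the Cartan subalgebra with
    (alpha_i, alpha_j) = d_i a_ij. *)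
Definition root_form (x y : dual (cartan D)) : K :=
  \sum_i \sum_j coord (simple_root D) i x * coord (simple_root D) j y
                * ((d i)%:R * (a i j)%:~R).

Definition simple_reflection (i : 'I_l) : 'End(dual (cartan D)) :=
  linfun (fun x : dual (cartan D) =>
    x - (x (coroot D i) : K) *: tnth (simple_root D) i).

(** s_pi(1) o ... o s_pi(l) *)
Definition coxeter (pi : 'S_l) : 'End(dual (cartan D)) :=
  \big[(fun s t => (s \o t)%VF) / (\1%VF)]_(k < l) simple_reflection (pi k).

(** (1 + s)/(1 - s); the inverse is the genuine one for a Coxeter element s,
    which does not have the eigenvalue 1. *)
Definition cayley (s : 'End(dual (cartan D))) : 'End(dual (cartan D)) :=
  ((\1 + s) \o (\1 - s)^-1)%VF.

Definition coxeter_matrix (pi : 'S_l) : 'M[K]_l :=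
  \matrix_(i, j) root_form (cayley (coxeter pi) (tnth (simple_root D) i))
                           (tnth (simple_root D) j).

End RootDatum.

(* Main.v *)
Require Import Defs.
From HB Require Import structures.
From mathcomp Require Import all_boot all_order all_fingroup all_algebra.
From mathcomp Require Import boolp reals complex.
From mathcomp Require Import finmap monalg zify ring generic_quotient.

(** Put Z_i = sum_p n_ip Y_p, so that prod_p L_p^(n_ip) = e^(h Z_i).  On the
    completed free algebra, x_i |-> x_i e^(h Z_i), y_i |-> e^(- h Z_i) y_i,
    H_i |-> H_i is an automorphism whose inverse is given by - n.  Since e^(h Z_i)
    q-commutes with X_j^+ and X_j^- with factors q^(d_j n_ij) and q^(- d_j n_ij),
    it multiplies the r-th term of a Serre relation by a constant times
    q^(- r (d_j n_ij - d_i n_ji)), and so maps the relations attached to c to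
    those attached to c - (d_j n_ij - d_i n_ji).  The standard quantum group being
    the case c = 0, the same computation for - n gives the inverse map.

    The q-commutation rules need the Cartan matrix to be invertible.  If
    t = sum_i u_i t_i is killed by all simple roots, t_i being the coroots, then
    0 = kappa(t, s) = sum_i u_i kappa(x_i, y_i) alpha_i(s) for the Killing form
    kappa and every s in the Cartan subalgebra, where t_i = [x_i, y_i]; so
    u_i kappa(x_i, y_i) = 0.  But 2 kappa(x_i, y_i) = kappa(t_i, t_i) is a sum of
    squares of integers, which are not all zero because [t_i, x_i] = 2 x_i. *)

Set Implicit Arguments.
Unset Strict Implicit.
Unset Printing Implicit Defensive.

Import Order.TTheory GRing.Theory Num.Theory passmx.
Local Open Scope ring_scope.

(** * Power series in h and the free algebra *)

Section FpsShift.

(** Multiplication by h, in a form that makes sense over any abelian group. *)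
Definition fps_shift (A : zmodType) (f : fps A) : fps A :=
  FPS (fun n => if n is m.+1 then f m else 0).

Lemma fps_split (A : zmodType) (f : fps A) :
  f = fpsC (f 0%N) + fps_shift (fps_tl f).
Proof. by apply: fpsP => -[|n]; rewrite coefhD /= ?addr0 ?add0r. Qed.

Variables U V W : zmodType.

(** Commuting with h forces h-adic continuity, so constants determine the map: what remains after
    splitting off the constant term is a multiple of h, and the coefficient of h^n in its image is a
    lower coefficient. Identities between series are thereby reduced to constants. *)
Lemma hlin_ext (T T' : fps U -> fps V) :
  {morph T : f g / f + g} -> {morph T' : f g / f + g} ->
  (forall f, T (fps_shift f) = fps_shift (T f)) ->
  (forall f, T' (fps_shift f) = fps_shift (T' f)) ->
  (forall u, T (fpsC u) = T' (fpsC u)) -> T =1 T'.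
Proof.
move=> TD T'D Th T'h TT' f; apply: fpsP => n.
elim/ltn_ind: n f => n IHn f; rewrite (fps_split f) TD T'D !coefhD TT' Th T'h.
by congr (_ + _); case: n IHn => //= n; apply.
Qed.

Variable op : U -> V -> W.

Lemma conv_shiftl f g :
  (forall v, op 0 v = 0) -> conv op (fps_shift f) g = fps_shift (conv op f g).
Proof.
move=> op0; apply: fpsP => -[|n] /=; first by rewrite big_ord1 /= op0.
by rewrite big_ord_recl /= op0 add0r.
Qed.

Lemma conv_shiftr f g :
  (forall u, op u 0 = 0) -> conv op f (fps_shift g) = fps_shift (conv op f g).
Proof.
move=> op0; apply: fpsP => n; rewrite conv_rev.
case: n => [|n]; first by rewrite big_ord1 /= op0.
by rewrite big_ord_recl /= op0 add0r -[RHS]/(conv op f g n) conv_rev.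
Qed.

End FpsShift.

Lemma fps_shift_mull (A : nzRingType) (f g : fps A) :
  fps_shift f * g = fps_shift (f * g).
Proof. by apply: conv_shiftl => x; exact: mul0r. Qed.

Lemma fps_shift_mulr (A : nzRingType) (f g : fps A) :
  f * fps_shift g = fps_shift (f * g).
Proof. by apply: conv_shiftr => x; exact: mulr0. Qed.

Section FpsConst.

Fact fpsC_zmod (A : zmodType) : zmod_morphism (@fpsC A).
Proof.
by move=> a b; apply: fpsP => -[|n]; rewrite coefhB //= subr0.
Qed.

HB.instance Definition _ (A : zmodType) :=
  GRing.isZmodMorphism.Build A (fps A) (@fpsC A) (@fpsC_zmod A).

Lemma coefh_mulCl (A : nzRingType) (a : A) f n : (fpsC a * f) n = a * f n.
Proof. by apply: conv_fpsCl => x; exact: mul0r. Qed.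

Lemma coefh_mulCr (A : nzRingType) (a : A) f n : (f * fpsC a) n = f n * a.
Proof. by apply: conv_fpsCr => x; exact: mulr0. Qed.

Fact fpsC_monoid (A : nzRingType) : monoid_morphism (@fpsC A).
Proof.
split=> // a b; apply: fpsP => -[|n]; rewrite coefh_mulCl //= mulr0 //.
Qed.

HB.instance Definition _ (A : nzRingType) :=
  GRing.isMonoidMorphism.Build A (fps A) (@fpsC A) (@fpsC_monoid A).

Lemma fpsCD (A : zmodType) (a b : A) : fpsC (a + b) = fpsC a + fpsC b.
Proof. exact: raddfD. Qed.

Lemma fpsCM (A : nzRingType) (a b : A) : fpsC (a * b) = fpsC a * fpsC b.
Proof. exact: rmorphM. Qed.

Variables (K : comNzRingType) (A : algType K).

Lemma coefh_scaleC (c : K) (f : fps A) n : (fpsC c *: f) n = c *: f n.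
Proof. by apply: conv_fpsCl => x; exact: scale0r. Qed.

Lemma fpsC_scale (c : K) (a : A) : fpsC c *: fpsC a = fpsC (c *: a).
Proof. by apply: fpsP => -[|n]; rewrite coefh_scaleC //= scaler0. Qed.

Lemma fps_shift_scale (c : fps K) (f : fps A) :
  c *: fps_shift f = fps_shift (c *: f).
Proof. by apply: conv_shiftr => x; exact: scaler0. Qed.

Lemma fps_shift_scalel (c : fps K) (f : fps A) :
  fps_shift c *: f = fps_shift (c *: f).
Proof. by apply: conv_shiftl => x; exact: scale0r. Qed.

Lemma hvar_shift : hvar K = fps_shift 1.
Proof. by apply: fpsP => -[|[|n]]. Qed.

Lemma hvar_scale (f : fps A) : hvar K *: f = fps_shift f.
Proof. by rewrite hvar_shift fps_shift_scalel scale1r. Qed.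

End FpsConst.

(** * Extension of a morphism from A to A[[h]] *)

Section Extension.
Variables (K : comNzRingType) (A B : algType K).
Variable phi : {rmorphism A -> fps B}.

(** The extension f |-> sum_i h^i phi(f_i). *)
Definition hext (f : fps A) : fps B :=
  FPS (fun n => \sum_(i < n.+1) phi (f i) (n - i)%N).

Fact hext_zmod : zmod_morphism hext.
Proof.
move=> f g; apply: fpsP => n; rewrite coefhB -sumrB.
by apply: eq_bigr => i _; rewrite coefhB rmorphB.
Qed.

HB.instance Definition _ :=
  GRing.isZmodMorphism.Build (fps A) (fps B) hext hext_zmod.

Lemma hextC a : hext (fpsC a) = phi a.
Proof.
apply: fpsP => n; rewrite /= big_ord_recl subn0 /= big1 ?addr0 // => i _.
by rewrite rmorph0.
Qed.

Lemma hext_shift f : hext (fps_shift f) = fps_shift (hext f).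
Proof.
apply: fpsP => -[|n] /=; first by rewrite big_ord1 /= rmorph0.
by rewrite big_ord_recl /= rmorph0 add0r.
Qed.

Fact hext_monoid : monoid_morphism hext.
Proof.
split=> [|f g]; first by rewrite -[1]/(fpsC 1) hextC rmorph1.
have D := raddfD hext.
move: f; apply: hlin_ext => [f f'|f f'|f|f|a].
- by rewrite mulrDl D.
- by rewrite D mulrDl.
- by rewrite fps_shift_mull hext_shift.
- by rewrite hext_shift fps_shift_mull.
move: g; apply: hlin_ext => [g g'|g g'|g|g|b].
- by rewrite mulrDr D.
- by rewrite D mulrDr.
- by rewrite fps_shift_mulr hext_shift.
- by rewrite hext_shift fps_shift_mulr.
by rewrite -rmorphM !hextC rmorphM.
Qed.

HB.instance Definition _ :=
  GRing.isMonoidMorphism.Build (fps A) (fps B) hext hext_monoid.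

Hypothesis phiZ : forall c a, phi (c *: a) = fpsC c *: phi a.

Lemma hext_scalable : scalable hext.
Proof.
have D := raddfD hext.
move=> c f; move: c; apply: hlin_ext => [c c'|c c'|c|c|c].
- by rewrite scalerDl D.
- by rewrite scalerDl.
- by rewrite fps_shift_scalel hext_shift.
- by rewrite fps_shift_scalel.
move: f; apply: hlin_ext => [f f'|f f'|f|f|a].
- by rewrite scalerDr D.
- by rewrite D scalerDr.
- by rewrite fps_shift_scale hext_shift.
- by rewrite hext_shift fps_shift_scale.
by rewrite fpsC_scale !hextC phiZ.
Qed.

(** Each phi(f_i) is a constant series, so only the term i = n reaches the coefficient of h^n. *)
Lemma hext_fix (f : fps A) (g : fps B) :
  (forall n, phi (f n) = fpsC (g n)) -> hext f = g.
Proof.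
move=> fg; apply: fpsP => n; rewrite /= big_ord_recr /= fg subnn /=.
by rewrite big1 ?add0r // => i _; rewrite fg /= subn_eq0 leqNgt ltn_ord.
Qed.

End Extension.

(** * Universal property of the free algebra *)

Section FreeUniversal.
Variables (K : comNzRingType) (I : choiceType) (B : algType K) (G : I -> fps B).

Definition fm_eval (m : {fmonom I}) : fps B := \prod_(i <- m) G i.

Fact fm_eval_mmorphism : mmorphism fm_eval.
Proof.
split=> [m1 m2|]; rewrite /fm_eval; first by rewrite fmM big_cat.
by rewrite fm1 big_nil.
Qed.

HB.instance Definition _ :=
  isMultiplicative.Build {fmonom I} (fps B) fm_eval fm_eval_mmorphism.

Definition hscal (c : K) : fps B := fpsC c%:A.

Fact hscal_zmod : zmod_morphism hscal.
Proof. by move=> c e; rewrite /hscal scalerBl raddfB. Qed.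
HB.instance Definition _ := GRing.isZmodMorphism.Build K (fps B) hscal hscal_zmod.

Fact hscal_monoid : monoid_morphism hscal.
Proof.
split=> [|c e]; rewrite /hscal ?scale1r //.
by rewrite -rmorphM -scalerAl mul1r scalerA.
Qed.
HB.instance Definition _ := GRing.isMonoidMorphism.Build K (fps B) hscal hscal_monoid.

Lemma hscalE c f : hscal c * f = fpsC c *: f.
Proof.
by apply: fpsP => n; rewrite coefh_mulCl coefh_scaleC mulr_algl.
Qed.

Lemma hscal_comm c f : GRing.comm (hscal c) f.
Proof. by apply: fpsP => n; rewrite coefh_mulCl coefh_mulCr mulr_algl mulr_algr. Qed.

Definition free_lift : free_alg K I -> fps B := mmap hscal fm_eval.

HB.instance Definition _ := GRing.Additive.on free_lift.

Fact free_lift_monoid : monoid_morphism free_lift.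
Proof.
by have [|fM f1] := @commr_mmap_is_multiplicative _ _ _ hscal fm_eval _;
  [move=> *; exact: hscal_comm | split].
Qed.

HB.instance Definition _ :=
  GRing.isMonoidMorphism.Build (free_alg K I) (fps B) free_lift free_lift_monoid.

Lemma free_liftZ c a : free_lift (c *: a) = fpsC c *: free_lift a.
Proof. by rewrite /free_lift mmapZ hscalE. Qed.

Lemma free_lift_gen i : free_lift (free_gen K i) = G i.
Proof. by rewrite /free_lift mmapU hscalE scale1r /= /fm_eval fmU big_seq1. Qed.

End FreeUniversal.

(** * Ideals of relations and exponentials *)

Section RelIdeal.
Variables (K : comNzRingType) (A : algType K) (S : fps A -> Prop).

(** An intersection of closed ideals is closed: the approximants z of a limit serve for every ideal
    J at once. *)
Lemma rel_ideal_closed : closed_ideal [in rel_ideal S].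
Proof.
split=> [|x y|u x|u x|x xlim]; first exact: rpred0.
- exact: rpredD.
- exact: rel_idealMl.
- exact: rel_idealMr.
apply/rel_idealP => J JI JS; have [_ _ _ _ Jc] := JI; apply: Jc => n.
by have [z /rel_idealP Iz] := xlim n; exists z; exact: Iz.
Qed.

Lemma fps_trunc (f : fps A) n :
  exists z, f = \sum_(i < n) hvar K ^+ i *: fpsC (f i) + hvar K ^+ n *: z.
Proof.
elim: n f => [|n IHn] f; first by exists f; rewrite big_ord0 add0r scale1r.
have [z def_f] := IHn (fps_tl f); exists z.
rewrite big_ord_recl expr0 scale1r {1}[f]fps_split -addrA; congr (_ + _).
rewrite -hvar_scale {1}def_f scalerDr scaler_sumr scalerA -exprS; congr (_ + _).
by apply: eq_bigr => i _; rewrite scalerA -exprS.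
Qed.

(** By closedness, since modulo h^n a series is a combination of its first n coefficients. *)
Lemma rel_ideal_coef (f : fps A) :
  (forall n, fpsC (f n) \in rel_ideal S) -> f \in rel_ideal S.
Proof.
move=> If; have [_ _ _ _ Ic] := rel_ideal_closed; apply: Ic => n.
have [z ->] := fps_trunc f n; exists z; rewrite addrK.
by apply: rpred_sum => i _; rewrite -mulr_algl rel_idealMl.
Qed.

(** Allows identities between exponentials in the quotient to be checked one power of h at a
    time. *)
Lemma pr_coef_eq (f g : fps A) :
  (forall n, pr S (fpsC (f n)) = pr S (fpsC (g n))) -> pr S f = pr S g.
Proof.
move=> fg; apply/pr_eq/rel_ideal_coef => n.
by rewrite coefhB raddfB; apply/pr_eq; apply: fg.
Qed.

Lemma prZ (c : fps K) (f : fps A) : pr S (c *: f) = c *: pr S f.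
Proof. exact: pr_scalable. Qed.

Lemma pr_scale_inj (c : K) (a b : A) :
  pr S (fpsC a) = pr S (fpsC b) -> pr S (fpsC (c *: a)) = pr S (fpsC (c *: b)).
Proof. by rewrite -!fpsC_scale !prZ => ->. Qed.

End RelIdeal.

(** The preimage of a closed ideal is a closed ideal; linearity over K[[h]] carries approximation
    modulo h^n along. *)
Lemma rel_ideal_morph (K : comNzRingType) (A B : algType K)
    (S : fps A -> Prop) (S' : fps B -> Prop)
    (T : {rmorphism fps A -> fps B}) :
  scalable T -> (forall r, S r -> T r \in rel_ideal S') ->
  forall x, x \in rel_ideal S -> T x \in rel_ideal S'.
Proof.
move=> TZ TS x /rel_idealP Ix; apply: (Ix (fun y => T y \in rel_ideal S')) => // {x Ix}.
have [I0 ID Il Ir Ic] := rel_ideal_closed S'.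
split=> [|y z Iy Iz|u y Iy|u y Iy|y ylim].
- by rewrite rmorph0.
- by rewrite rmorphD; apply: ID.
- by rewrite rmorphM; apply: Il.
- by rewrite rmorphM; apply: Ir.
apply: Ic => n; have [z Iz] := ylim n; exists (T z).
by rewrite -TZ -rmorphB.
Qed.

(** * Exponentials modulo the relations *)

Section HexpRel.
Variables (K : numFieldType) (A : algType K).
Implicit Types a b z x : A.

Lemma hexpM_coef a b n : (hexp a * hexp b) n =
  n`!%:R^-1 *: \sum_(i < n.+1) (a ^+ (n - i) * b ^+ i) *+ 'C(n, i).
Proof.
rewrite [LHS]conv_rev scaler_sumr; apply: eq_bigr => i _ /=.
rewrite -scalerAl -scalerAr scalerA -scaler_nat scalerA; congr (_ *: _).
have le_in : (i <= n)%N by rewrite -ltnS.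
rewrite -(bin_fact le_in) !natrM !invfM mulrAC mulrA.
rewrite mulVf ?mul1r 1?mulrC //.
by rewrite pnatr_eq0 -lt0n bin_gt0.
Qed.

Lemma hexpD a b : GRing.comm a b -> hexp (a + b) = hexp a * hexp b.
Proof.
by move=> cab; apply: fpsP => n; rewrite hexpM_coef /= exprDn_comm.
Qed.

Lemma hexp0 : hexp (0 : A) = 1.
Proof.
apply: fpsP => -[|n]; first by rewrite /= fact0 invr1 scale1r.
by rewrite /= expr0n scaler0.
Qed.

Lemma hexpVr a : hexp a * hexp (- a) = 1.
Proof. by rewrite -hexpD ?subrr ?hexp0 //; apply: commrN. Qed.

Lemma hexpVl a : hexp (- a) * hexp a = 1.
Proof. by rewrite -{2}[a]opprK hexpVr. Qed.

Lemma hexp_scalar (c : K) : hexp (c%:A : A) = qpow c *: 1.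
Proof.
apply: fpsP => n; rewrite [RHS]conv_fpsCr => [|k]; last exact: scaler0.
by rewrite /= exprZn expr1n scalerA mulrC.
Qed.

Lemma hexpDscalar a (c : K) : hexp (a + c%:A) = qpow c *: hexp a.
Proof.
rewrite hexpD ?hexp_scalar -?scalerAr ?mulr1 //.
by rewrite /GRing.comm mulr_algr mulr_algl.
Qed.

Variable S : fps A -> Prop.
Local Notation cst a := (pr S (fpsC a)).

(** Here a and b commute in the quotient only, so the binomial theorem is applied to the images of
    the constants. *)
Lemma pr_hexpD a b : cst a * cst b = cst b * cst a ->
  pr S (hexp (a + b)) = pr S (hexp a) * pr S (hexp b).
Proof.
move=> cab; rewrite -rmorphM; apply: pr_coef_eq => n.
rewrite hexpM_coef; apply: pr_scale_inj.
rewrite !rmorphXn !rmorphD !rmorph_sum exprDn_comm //.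
by apply: eq_bigr => i _; rewrite !rmorphMn !rmorphM !rmorphXn.
Qed.

(** From z x = x (z + c) follows z^n x = x (z + c)^n; summed against h^n / n! this gives e^(hz) x =
    x e^(h(z + c)) = q^c x e^(hz). *)
Lemma pr_hexp_comm z x (c : K) :
  cst z * cst x = cst x * cst z + fpsC c *: cst x ->
  pr S (hexp z) * cst x = qpow c *: (cst x * pr S (hexp z)).
Proof.
move=> zx; rewrite presented_scalerAr -prZ -hexpDscalar -!rmorphM.
apply: pr_coef_eq => n; rewrite coefh_mulCl coefh_mulCr /=.
rewrite -scalerAl -scalerAr; apply: pr_scale_inj.
rewrite !rmorphM !rmorphXn /=; elim: n => [|n IHn]; first by rewrite mul1r mulr1.
rewrite exprS -mulrA IHn mulrA zx exprS [RHS]mulrA; congr (_ * _).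
rewrite !rmorphD /= mulrDr; congr (_ + _).
by rewrite -fpsC_scale prZ -presented_scalerAr !rmorph1 mulr1.
Qed.

Lemma pr_hexp_commute a b : cst a * cst b = cst b * cst a ->
  pr S (hexp a) * pr S (hexp b) = pr S (hexp b) * pr S (hexp a).
Proof. by move=> cab; rewrite -!pr_hexpD // addrC. Qed.

Lemma pr_weight_sum (I : finType) (H : I -> A) x (v chi : I -> K) :
  (forall k, cst (H k) * cst x = cst x * cst (H k) + fpsC (chi k) *: cst x) ->
  cst (\sum_k v k *: H k) * cst x =
    cst x * cst (\sum_k v k *: H k) + fpsC (\sum_k v k * chi k) *: cst x.
Proof.
move=> Hx; rewrite !raddf_sum /= mulr_suml mulr_sumr scaler_suml -big_split.
apply: eq_bigr => k _ /=; rewrite -fpsC_scale prZ -presented_scalerAl Hx scalerDr.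
by rewrite presented_scalerAr scalerA fpsCM.
Qed.

Lemma pr_comb_comm (I : finType) (H : I -> A) (v w : I -> K) :
  (forall j k, cst (H j) * cst (H k) = cst (H k) * cst (H j)) ->
  cst (\sum_k v k *: H k) * cst (\sum_k w k *: H k) =
    cst (\sum_k w k *: H k) * cst (\sum_k v k *: H k).
Proof.
move=> HH; rewrite !raddf_sum /= !mulr_sumr.
under [RHS]eq_bigr => j _ do rewrite mulr_suml.
rewrite exchange_big; apply: eq_bigr => k _; rewrite mulr_suml; apply: eq_bigr => j _.
rewrite -!fpsC_scale !prZ -!presented_scalerAl -!presented_scalerAr HH.
by rewrite !scalerA mulrC.
Qed.

Lemma pr_hexp_sum (I : Type) (r : seq I) (w : I -> A) :
  (forall j k, cst (w j) * cst (w k) = cst (w k) * cst (w j)) ->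
  pr S (hexp (\sum_(k <- r) w k)) = \prod_(k <- r) pr S (hexp (w k)).
Proof.
move=> ww; elim: r => [|k r IHr]; first by rewrite !big_nil hexp0 rmorph1.
rewrite !big_cons pr_hexpD ?IHr // !raddf_sum /= mulr_sumr mulr_suml.
by apply: eq_bigr => j _; exact: ww.
Qed.

End HexpRel.

(** * q-commutation *)

Section QPow.
Variable K : numFieldType.

Lemma qpowD (c e : K) : qpow (c + e) = qpow c * qpow e.
Proof.
have qE (x : K) : qpow x = hexp (x : K^o).
  by apply: fpsP => n; rewrite /= mulrC.
by rewrite !qE (hexpD (A := K^o)) //; exact: mulrC.
Qed.

Lemma qpow0 : qpow (0 : K) = 1.
Proof. by apply: fpsP => -[|n]; rewrite /= ?invr1 ?mulr1 // expr0n mul0r. Qed.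

End QPow.

(** Collects the powers of u in [qcomm_word]: a pair from a disjoint union lies in one part or meets
    both. *)
Lemma bin2_add k r : 'C((k + r)%N, 2) = ('C(k, 2) + 'C(r, 2) + k * r)%N.
Proof. elim: k => [|k IHk]; first by rewrite bin0n addn0.
rewrite addSn !binS !bin1 IHk; lia.
Qed.

Section QComm.
Variables (K : comNzRingType) (A : algType (fps K)) (S : A -> Prop).
Local Notation P := (presented S).
Implicit Types (x y e f : P) (u v w : fps K).


Definition qcomm e x u := e * x = u *: (x * e).

Lemma qcommMl e f x u v : qcomm e x u -> qcomm f x v -> qcomm (e * f) x (u * v).
Proof.
rewrite /qcomm => ex fx.
by rewrite -mulrA fx -presented_scalerAr mulrA ex -presented_scalerAl scalerA mulrC mulrA.
Qed.

Lemma qcommMr e x y u v : qcomm e x u -> qcomm e y v -> qcomm e (x * y) (u * v).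
Proof.
rewrite /qcomm => ex ey.
by rewrite mulrA ex -presented_scalerAl -mulrA ey -presented_scalerAr scalerA mulrA.
Qed.

Lemma qcommXl e x u k : qcomm e x u -> qcomm (e ^+ k) x (u ^+ k).
Proof.
move=> ex; elim: k => [|k IHk]; first by rewrite /qcomm scale1r mul1r mulr1.
by rewrite !exprS; apply: qcommMl.
Qed.

Lemma qcommXr e x u k : qcomm e x u -> qcomm e (x ^+ k) (u ^+ k).
Proof.
move=> ex; elim: k => [|k IHk]; first by rewrite /qcomm scale1r mul1r mulr1.
by rewrite !exprS; apply: qcommMr.
Qed.

Lemma scale_exp u x k : (u *: x) ^+ k = u ^+ k *: x ^+ k.
Proof.
elim: k => [|k IHk]; first by rewrite scale1r.
by rewrite !exprS IHk -presented_scalerAr -presented_scalerAl scalerA mulrC.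
Qed.

(** Bringing every e to the right makes one e cross one x for each pair of positions. *)
Lemma qcomm_exp e x u k :
  qcomm e x u -> (x * e) ^+ k = u ^+ 'C(k, 2) *: (x ^+ k * e ^+ k).
Proof.
move=> ex; elim: k => [|k IHk]; first by rewrite scale1r mulr1.
rewrite exprSr IHk -presented_scalerAl -mulrA (mulrA _ x e) (qcommXl k ex).
rewrite -!presented_scalerAl -!presented_scalerAr scalerA -exprD binS bin1 addnC.
by rewrite !exprSr !mulrA addnC.
Qed.

(** Once e and e' stand on the right, the exponent of u is 'C(m, 2) whatever r is, so the terms of a
    Serre sum gain scalars that differ only in v^(m - r) w^r. *)
Lemma qcomm_word e e' x x' u v w m r :
  qcomm e x u -> qcomm e x' v -> qcomm e' x w -> e * e' = e' * e -> (r <= m)%N ->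
  (x * e) ^+ (m - r) * (x' * e') * (x * e) ^+ r =
  (u ^+ 'C(m, 2) * (v ^+ (m - r) * w ^+ r)) *:
     ((x ^+ (m - r) * x' * x ^+ r) * (e ^+ m * e')).
Proof.
move=> ex ex' e'x ee' le_rm; set k := (m - r)%N.
rewrite !(qcomm_exp _ ex) -!presented_scalerAl -presented_scalerAr scalerA.
have Ekx' : e ^+ k * x' = v ^+ k *: (x' * e ^+ k) by exact: qcommXl.
have Ekx : (e ^+ k * e') * x ^+ r = (u ^+ (k * r) * w ^+ r) *: (x ^+ r * (e ^+ k * e')).
  by rewrite exprM; apply: qcommMl; apply: qcommXr => //; apply: qcommXl.
transitivity ((u ^+ 'C(k, 2) * u ^+ 'C(r, 2)) *:
    (x ^+ k * (e ^+ k * x') * e' * x ^+ r * e ^+ r)); first by rewrite !mulrA.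
rewrite Ekx' -presented_scalerAr -!presented_scalerAl scalerA.
transitivity ((u ^+ 'C(k, 2) * u ^+ 'C(r, 2) * v ^+ k) *:
    (x ^+ k * x' * ((e ^+ k * e') * x ^+ r) * e ^+ r)); first by rewrite !mulrA.
rewrite Ekx -presented_scalerAr -presented_scalerAl scalerA.
have ekr : e ^+ k * e' * e ^+ r = e ^+ m * e'.
  by rewrite -mulrA (commrX r (esym ee')) mulrA -exprD subnK.
have -> : x ^+ k * x' * (x ^+ r * (e ^+ k * e')) * e ^+ r =
    x ^+ k * x' * x ^+ r * (e ^+ m * e') by rewrite -ekr !mulrA.
congr (_ *: _).
have -> : 'C(m, 2) = ('C(k, 2) + 'C(r, 2) + k * r)%N by rewrite -(subnK le_rm) bin2_add.
by rewrite !exprD -!mulrA; congr (_ * (_ * _)); rewrite mulrCA.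
Qed.

(** The condition t w = t' v turns t^r v^(m - r) w^r into t'^r v^m, so a common factor leaves the
    sum and the Serre parameter changes from t to t'. *)
Lemma qcomm_serre e e' x x' u v w t t' m (b : nat -> fps K) :
  qcomm e x u -> qcomm e x' v -> qcomm e' x w -> e * e' = e' * e ->
  t * w = t' * v ->
  \sum_(r < m.+1) ((-1) ^+ r * t ^+ r * b r) *:
     ((x * e) ^+ (m - r) * (x' * e') * (x * e) ^+ r) =
  (u ^+ 'C(m, 2) * v ^+ m) *:
     ((\sum_(r < m.+1) ((-1) ^+ r * t' ^+ r * b r) *: (x ^+ (m - r) * x' * x ^+ r))
      * (e ^+ m * e')).
Proof.
move=> ex ex' e'x ee' tw; rewrite mulr_suml scaler_sumr; apply: eq_bigr => r _.
have le_rm : (r <= m)%N by rewrite -ltnS.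
rewrite (qcomm_word ex ex' e'x ee' le_rm) scalerA -presented_scalerAl scalerA.
congr (_ *: _).
have tvw : t ^+ r * (v ^+ (m - r) * w ^+ r) = t' ^+ r * v ^+ m.
  by rewrite mulrCA -exprMn tw exprMn mulrCA -exprD subnK.
transitivity ((-1) ^+ r * b r * u ^+ 'C(m, 2) * (t ^+ r * (v ^+ (m - r) * w ^+ r))).
  ring.
rewrite tvw; ring.
Qed.

End QComm.

(** * The twist of the free algebra *)

Lemma free_alg_ind (K : comNzRingType) (I : choiceType) (P : free_alg K I -> Prop) :
  (forall x y, P x -> P y -> P (x + y)) -> (forall c x, P x -> P (c *: x)) ->
  P 1 -> (forall x y, P x -> P y -> P (x * y)) -> (forall i, P (free_gen K i)) ->
  forall x, P x.
Proof.
move=> PD PZ P1 PM PG x; rewrite [x]monalgE.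
elim/big_ind: _ => [||k _]; [by rewrite -(scale0r 1); exact: PZ | exact: PD |].
have -> : << x@_k *g k >> = x@_k *: << k >>.
  by apply/malgP => j; rewrite mcoeffZ !mcoeffU mulrnAr mulr1.
apply: PZ; case: k => s; elim: s => [|i s IHs].
  by rewrite -fmoneE.
have -> : FMonom (i :: s) = mmul (fmu i) (FMonom s).
  by apply/eqP; rewrite fmP [X in _ == X]fmM fmU.
have -> : << mmul (fmu i) (FMonom s) >> = free_gen K i * << FMonom s >>.
  by rewrite -[RHS]/(fgmul _ _) fgmulUU mulr1.
exact: PM.
Qed.

(** [hlin_ext] reduces the claim to constants, and induction on the free algebra reduces it to
    generators. *)
Lemma free_fps_morph_id (K : comNzRingType) (I : choiceType)
    (T : {rmorphism fps (free_alg K I) -> fps (free_alg K I)}) :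
  scalable T -> (forall i, T (fpsC (free_gen K i)) = fpsC (free_gen K i)) -> T =1 id.
Proof.
move=> TZ TG; apply: hlin_ext => // [f g|f|w]; first exact: rmorphD.
  by rewrite -hvar_scale TZ hvar_scale.
elim/free_alg_ind: w => [x y Px Py|c x Px||x y Px Py|i] //.
- by rewrite fpsCD rmorphD /= Px Py.
- by rewrite -fpsC_scale TZ Px.
- exact: rmorph1.
- by rewrite fpsCM rmorphM /= Px Py.
Qed.

Section Twist.
Variables (K : numFieldType) (l : nat) (a : 'M[int]_l) (d : 'I_l -> nat).
Local Notation F := (free_gens K l).
Local Notation A := (free_alg K (gens l)).
Implicit Types (n c : 'M[K]_l).

(** The product of the L_p^(n_ip) is e^(h Z_i); using one exponential instead
    makes [twist (- n)] inverse to [twist n] already on the free algebra, where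
    the H_j do not commute. *)
Definition twist_exponent n (i : 'I_l) : A := \sum_p n i p *: Y0 K a d p.

Definition twist_gen n (g : gens l) : F :=
  match g with
  | inl (inl i) => genH K i
  | inl (inr i) => genx K i * hexp (twist_exponent n i)
  | inr i => hexp (- twist_exponent n i) * geny K i
  end.

Definition twist n : F -> F := hext (free_lift (twist_gen n)).

HB.instance Definition _ n := GRing.RMorphism.on (twist n).

Lemma twistZ n : scalable (twist n).
Proof. by apply: hext_scalable; exact: free_liftZ. Qed.

Lemma twistH n i : twist n (genH K i) = genH K i.
Proof. by rewrite /twist hextC; exact: free_lift_gen. Qed.

Lemma twistx n i : twist n (genx K i) = genx K i * hexp (twist_exponent n i).
Proof. by rewrite /twist hextC; exact: free_lift_gen. Qed.

Lemma twisty n i : twist n (geny K i) = hexp (- twist_exponent n i) * geny K i.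
Proof. by rewrite /twist hextC; exact: free_lift_gen. Qed.

Definition twist_fixed n (w : A) := free_lift (twist_gen n) w = fpsC w.

Lemma twist_fixed_Hcomb n (v : 'I_l -> K) : twist_fixed n (\sum_k v k *: H0 K k).
Proof.
rewrite /twist_fixed !raddf_sum; apply: eq_bigr => k _.
by rewrite /= free_liftZ [free_lift _ _]free_lift_gen fpsC_scale.
Qed.

Lemma twist_fixed_hexp_coef n w k :
  twist_fixed n w -> twist_fixed n (hexp w k).
Proof.
rewrite /twist_fixed => nw.
by rewrite /= free_liftZ rmorphXn /= nw -rmorphXn fpsC_scale.
Qed.

Lemma twist_hexp n w : twist_fixed n w -> twist n (hexp w) = hexp w.
Proof. by move=> nw; apply: hext_fix => k; exact: twist_fixed_hexp_coef. Qed.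

(** Its coefficients involve H_i alone, which the twist fixes. *)
Lemma twist_Kfrac n i : twist n (Kfrac K d i) = Kfrac K d i.
Proof.
rewrite /Kfrac /hdiv twistZ; congr (_ *: _); apply: hext_fix => k.
have nH e : twist_fixed n (e *: H0 K i).
  by rewrite /twist_fixed free_liftZ [free_lift _ _]free_lift_gen fpsC_scale.
rewrite [fps_tl _ _]coefhB !rmorphB; congr (_ - _); apply: twist_fixed_hexp_coef => //.
by rewrite -scaleNr.
Qed.

Lemma twist_exponentE n i : twist_exponent n i =
  \sum_k (\sum_p n i p * ((d p)%:R * invmx (map_mx intr a : 'M[K]_l) p k)) *: H0 K k.
Proof.
under [RHS]eq_bigr => k _ do rewrite scaler_suml.
rewrite exchange_big; apply: eq_bigr => p _.
by rewrite /Y0 scaler_sumr; apply: eq_bigr => k _; rewrite scalerA.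
Qed.

Lemma twist_exponentN n i : twist_exponent (- n) i = - twist_exponent n i.
Proof. by rewrite -sumrN; apply: eq_bigr => p _; rewrite mxE scaleNr. Qed.

Lemma twist_exponent_fixed n n' i : twist_fixed n' (twist_exponent n i).
Proof. by rewrite twist_exponentE; exact: twist_fixed_Hcomb. Qed.

Lemma twist_fixedN n w : twist_fixed n w -> twist_fixed n (- w).
Proof. by rewrite /twist_fixed !rmorphN /= => ->. Qed.

(** Since e^(hZ_i) is a series in the H_k, every twist fixes it. The composite therefore multiplies
    x_i and y_i by e^(-hZ_i) e^(hZ_i) = 1 and fixes all generators. *)
Lemma twistK n : cancel (twist n) (twist (- n)).
Proof.
have twM n' f g : twist n' (f * g) = twist n' f * twist n' g by exact: rmorphM.
apply: (@free_fps_morph_id _ _ (twist (- n) \o twist n)) => [c f|[[i|i]|i]].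
- by rewrite /= !twistZ.
- by rewrite /= !twistH.
- rewrite /= twistx twM twistx twist_hexp; last exact: twist_exponent_fixed.
  by rewrite twist_exponentN -mulrA hexpVl mulr1.
- rewrite /= twisty twM twisty twist_hexp; last exact/twist_fixedN/twist_exponent_fixed.
  by rewrite twist_exponentN mulrA (hexpVr (- twist_exponent n i)) mul1r.
Qed.

End Twist.

(** * The twisted relations *)

Section Relations.
Variables (K : comNzRingType) (F A : algType (fps K)) (S : A -> Prop).
Local Notation P := (presented S).
Variable g : {rmorphism F -> P}.
Hypothesis gZ : scalable g.
Implicit Types (x y z : F) (X Y E : P) (c s t u v w : fps K).

Lemma morph_commutator x z :
  g z * g x = g x * g z <-> g (z * x - x * z) = 0.
Proof. by rewrite rmorphB !rmorphM; split=> [->|/subr0_eq]; rewrite ?subrr. Qed.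

Lemma morph_weight c x z :
  g z * g x = g x * g z + c *: g x <-> g (z * x - x * z - c *: x) = 0.
Proof.
rewrite !rmorphB !rmorphM gZ /=; split=> [->|/subr0_eq/eqP].
  by rewrite addrAC addrK subrr.
by rewrite subr_eq addrC => /eqP.
Qed.

(** E commutes with h, so X E has the weight of X. *)
Lemma morph_weight_mulr c x z h X E :
  g z = h -> g x = X * E -> h * X = X * h + c *: X -> E * h = h * E ->
  g (z * x - x * z - c *: x) = 0.
Proof.
move=> gz gx hX hE; apply/morph_weight; rewrite gz gx.
by rewrite mulrA hX mulrDl -presented_scalerAl -!mulrA hE.
Qed.

Lemma morph_weight_mull c x z h X E :
  g z = h -> g x = E * X -> h * X = X * h + c *: X -> E * h = h * E ->
  g (z * x - x * z - c *: x) = 0.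
Proof.
move=> gz gx hX hE; apply/morph_weight; rewrite gz gx.
by rewrite mulrA -hE -mulrA hX mulrDr -presented_scalerAr mulrA.
Qed.

(** Moving E E' to the right of both products costs v u in the first and u w in the second. As s w =
    v s', the factor v u comes out, leaving the relation between X and Y times E E'. *)
Lemma morph_ef s s' u v w x y z X Y E E' k :
  g x = X * E -> g y = E' * Y ->
  qcomm E Y v -> qcomm E' Y u -> qcomm E' X w -> E * E' = E' * E ->
  s * w = v * s' -> X * Y - s' *: (Y * X) = k -> (v * u) *: (k * (E * E')) = g z ->
  g (x * y - s *: (y * x) - z) = 0.
Proof.
move=> gx gy EY E'Y E'X EE' sw XY kz; rewrite rmorphB -kz -XY rmorphB gZ !rmorphM gx gy.
apply/eqP; rewrite subr_eq0; apply/eqP.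
have -> : X * E * (E' * Y) = (v * u) *: (X * Y * (E * E')).
  rewrite -mulrA (mulrA E) [E * E' * Y](qcommMl EY E'Y).
  by rewrite -presented_scalerAr mulrA.
have -> : E' * Y * (X * E) = (u * w) *: (Y * X * (E * E')).
  rewrite mulrA -(mulrA E') [E' * (Y * X)](qcommMr E'Y E'X).
  by rewrite -presented_scalerAl EE' mulrA.
rewrite mulrBl scalerBr -presented_scalerAl !scalerA; congr (_ - _ *: _).
by rewrite mulrCA sw; ring.
Qed.

Lemma morph_word (b : nat -> fps K) m x y :
  g (\sum_(r < m.+1) b r *: (x ^+ (m - r) * y * x ^+ r)) =
  \sum_(r < m.+1) b r *: (g x ^+ (m - r) * g y * g x ^+ r).
Proof.
rewrite rmorph_sum; apply: eq_bigr => r _.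
by rewrite gZ !rmorphM !rmorphXn.
Qed.

Lemma morph_serre_x e e' X X' u v w t t' m (b : nat -> fps K) x y :
  g x = X * e -> g y = X' * e' ->
  qcomm e X u -> qcomm e X' v -> qcomm e' X w -> e * e' = e' * e ->
  t * w = t' * v ->
  \sum_(r < m.+1) ((-1) ^+ r * t' ^+ r * b r) *: (X ^+ (m - r) * X' * X ^+ r) = 0 ->
  g (\sum_(r < m.+1) ((-1) ^+ r * t ^+ r * b r) *: (x ^+ (m - r) * y * x ^+ r)) = 0.
Proof.
move=> gx gy eX eX' e'X ee' tw S0.
rewrite (morph_word (fun r => (-1) ^+ r * t ^+ r * b r)) gx gy.
by rewrite (qcomm_serre m b eX eX' e'X ee' tw) S0 mul0r scaler0.
Qed.

(** The images are e X rather than X e. Exchanging the factors costs u for each of the m letters e X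
    and u' for the single letter e' X', a scalar common to all words, after which [qcomm_serre]
    applies. *)
Lemma morph_serre_y e e' X X' u u' v w t t' m (b : nat -> fps K) x y :
  g x = e * X -> g y = e' * X' ->
  qcomm e X u -> qcomm e' X' u' -> qcomm e X' v -> qcomm e' X w -> e * e' = e' * e ->
  t * w = t' * v ->
  \sum_(r < m.+1) ((-1) ^+ r * t' ^+ r * b r) *: (X ^+ (m - r) * X' * X ^+ r) = 0 ->
  g (\sum_(r < m.+1) ((-1) ^+ r * t ^+ r * b r) *: (x ^+ (m - r) * y * x ^+ r)) = 0.
Proof.
move=> gx gy eX e'X' eX' e'X ee' tw S0.
rewrite (morph_word (fun r => (-1) ^+ r * t ^+ r * b r)) gx gy eX e'X'.
transitivity ((u ^+ m * u') *: \sum_(r < m.+1) ((-1) ^+ r * t ^+ r * b r) *: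
     ((X * e) ^+ (m - r) * (X' * e') * (X * e) ^+ r)).
  rewrite scaler_sumr; apply: eq_bigr => r _.
  have le_rm : (r <= m)%N by rewrite -ltnS.
  rewrite !scale_exp -!presented_scalerAl -!presented_scalerAr.
  rewrite -!presented_scalerAl !scalerA; congr (_ *: _).
  have -> : u ^+ m = u ^+ (m - r) * u ^+ r by rewrite -exprD subnK.
  ring.
by rewrite (qcomm_serre m b eX eX' e'X ee' tw) S0 mul0r !scaler0.
Qed.

End Relations.

Section Relators.
Variables (K : comNzRingType) (A : algType (fps K)) (S : A -> Prop).

Lemma pr_rel0 r : S r -> pr S r = 0.
Proof.
move=> Sr; rewrite -(rmorph0 (pr S)); apply/pr_eq; rewrite subr0.
by apply/rel_idealP => J _; apply.
Qed.

Lemma pr_ef_rel x y z s :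
  S (x * y - s *: (y * x) - z) -> pr S x * pr S y - s *: (pr S y * pr S x) = pr S z.
Proof.
move=> /pr_rel0; rewrite !rmorphB => /subr0_eq <- /=.
by rewrite [pr S (s *: _)](@pr_scalable _ _ S) !rmorphM.
Qed.

Lemma pr_word_rel (b : nat -> fps K) m x y :
  S (\sum_(r < m.+1) b r *: (x ^+ (m - r) * y * x ^+ r)) ->
  \sum_(r < m.+1) b r *: (pr S x ^+ (m - r) * pr S y * pr S x ^+ r) = 0.
Proof. by move=> /pr_rel0; rewrite (morph_word (@pr_scalable _ _ S)). Qed.

End Relators.

(** * Weights of the exponentials in the algebra attached to c *)

Section TwistRelations.
Variables (K : numFieldType) (l : nat) (a : 'M[int]_l) (d : 'I_l -> nat).
Variables (c : 'M[K]_l).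
Local Notation F := (free_gens K l).
Local Notation S := (cox_rel a d c).
Local Notation P := (presented S).
Hypothesis a_unit : map_mx intr a \in (unitmx : pred 'M[K]_l).

Local Notation H := (fun i => pr S (genH K i)).
Local Notation X := (fun i => pr S (genx K i)).
Local Notation Y := (fun i => pr S (geny K i)).

Lemma cox_H_comm i j : H i * H j = H j * H i.
Proof. by apply/(morph_commutator (pr S))/pr_rel0; exact: cox_HH. Qed.

Lemma cox_H_x i j : H i * X j = X j * H i + fpsC (a i j)%:~R *: X j.
Proof.
rewrite [fpsC _]rmorph_int; apply/(morph_weight (@pr_scalable _ _ S))/pr_rel0.
exact: cox_He.
Qed.

Lemma cox_H_y i j : H i * Y j = Y j * H i + fpsC (- (a i j)%:~R) *: Y j.
Proof.
rewrite [fpsC _]rmorphN /= [fpsC _]rmorph_int.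
apply/(morph_weight (@pr_scalable _ _ S))/pr_rel0.
by rewrite scaleNr opprK; exact: cox_Hf.
Qed.

Variable n : 'M[K]_l.
Local Notation Z := (twist_exponent a d n).

(** The identity a^-1 a = 1 says that Y_p has weight d_j on X_j for p = j and weight 0 otherwise. *)
Lemma twist_exponent_weight i j :
  \sum_k (\sum_p n i p * ((d p)%:R * invmx (map_mx intr a : 'M[K]_l) p k)) * (a k j)%:~R
  = (d j)%:R * n i j.
Proof.
under eq_bigr => k _ do rewrite mulr_suml.
rewrite exchange_big /=.
transitivity (\sum_p n i p * (d p)%:R *
    (invmx (map_mx intr a : 'M[K]_l) *m map_mx intr a) p j).
  apply: eq_bigr => p _; rewrite mxE mulr_sumr; apply: eq_bigr => k _.
  by rewrite [map_mx _ _ _ _]mxE !mulrA.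
rewrite (mulVmx a_unit) (bigD1 j) //= big1 => [|p pj].
  by rewrite addr0 mxE eqxx mulr1 mulrC.
by rewrite mxE (negPf pj) mulr0.
Qed.

Lemma cox_Z_x i j :
  pr S (fpsC (Z i)) * X j = X j * pr S (fpsC (Z i)) + fpsC ((d j)%:R * n i j) *: X j.
Proof.
rewrite -twist_exponent_weight twist_exponentE.
by apply: pr_weight_sum => k; exact: cox_H_x.
Qed.

Lemma cox_Z_y i j :
  pr S (fpsC (Z i)) * Y j = Y j * pr S (fpsC (Z i)) + fpsC (- ((d j)%:R * n i j)) *: Y j.
Proof.
have -> : - ((d j)%:R * n i j) =
    \sum_k (\sum_p n i p * ((d p)%:R * invmx (map_mx intr a : 'M[K]_l) p k)) *
      (- (a k j)%:~R).
  rewrite -twist_exponent_weight -sumrN.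
  by apply: eq_bigr => k _; rewrite mulrN.
by rewrite twist_exponentE; apply: pr_weight_sum => k; exact: cox_H_y.
Qed.

Lemma cox_Z_H i j :
  pr S (fpsC (Z i)) * H j = H j * pr S (fpsC (Z i)) + fpsC 0 *: H j.
Proof.
(* Every H_k has weight 0 on H_j; the total weight is written as a sum of zeros to fit
   [pr_weight_sum]. *)
have -> : 0 = \sum_k
    (\sum_p n i p * ((d p)%:R * invmx (map_mx intr a : 'M[K]_l) p k)) * 0 :> K.
  by rewrite big1 // => k _; rewrite mulr0.
rewrite twist_exponentE; apply: pr_weight_sum => k.
by rewrite raddf0 scale0r addr0; exact: cox_H_comm.
Qed.

Lemma cox_Z_comm i j :
  pr S (fpsC (Z i)) * pr S (fpsC (Z j)) = pr S (fpsC (Z j)) * pr S (fpsC (Z i)).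
Proof.
by rewrite !twist_exponentE; apply: pr_comb_comm => k p; exact: cox_H_comm.
Qed.

Local Notation E := (fun i => pr S (hexp (Z i))).

Lemma cox_E_x i j : qcomm (E i) (X j) (qpow ((d j)%:R * n i j)).
Proof. by apply: pr_hexp_comm; exact: cox_Z_x. Qed.

Lemma cox_E_y i j : qcomm (E i) (Y j) (qpow (- ((d j)%:R * n i j))).
Proof. by apply: pr_hexp_comm; exact: cox_Z_y. Qed.

Lemma cox_E_H i j : E i * H j = H j * E i.
Proof.
rewrite -[RHS]scale1r -(qpow0 K).
by apply: pr_hexp_comm; exact: cox_Z_H.
Qed.

End TwistRelations.

Lemma comm_inverse (R : pzRingType) (x y z : R) :
  y * z = 1 -> z * y = 1 -> x * y = y * x -> x * z = z * x.
Proof.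
by move=> yz zy xy; rewrite -[LHS]mul1r -zy -mulrA (mulrA y) -xy -(mulrA x) yz mulr1.
Qed.

(** * The twist as a morphism between the algebras attached to c and c' *)

Section TwistHom.
Variables (K : numFieldType) (l : nat) (a : 'M[int]_l) (d : 'I_l -> nat).
Local Notation F := (free_gens K l).
Hypothesis a_unit : map_mx intr a \in (unitmx : pred 'M[K]_l).
Variables (c c' n : 'M[K]_l).
Hypothesis n_eq :
  forall i j, (d j)%:R * n i j - (d i)%:R * n j i = c i j - c' i j.
Local Notation S := (cox_rel a d c').
Local Notation P := (presented S).
Local Notation H := (fun i => pr S (genH K i)).
Local Notation X := (fun i => pr S (genx K i)).
Local Notation Y := (fun i => pr S (geny K i)).
Local Notation Z := (twist_exponent a d n).

Let E i : P := pr S (hexp (Z i)).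
Let E' i : P := pr S (hexp (- Z i)).

Let oppnE i j : - n i j = (- n) i j. Proof. by rewrite mxE. Qed.

Let E_x i j : qcomm (E i) (X j) (qpow ((d j)%:R * n i j)).
Proof. exact: cox_E_x. Qed.

Let E_y i j : qcomm (E i) (Y j) (qpow (- ((d j)%:R * n i j))).
Proof. exact: cox_E_y. Qed.

Let E'_x i j : qcomm (E' i) (X j) (qpow (- ((d j)%:R * n i j))).
Proof. by rewrite -mulrN /E' -twist_exponentN oppnE; exact: cox_E_x. Qed.

Let E'_y i j : qcomm (E' i) (Y j) (qpow ((d j)%:R * n i j)).
Proof.
rewrite -[qpow _](congr1 (@qpow K) (opprK _)) -mulrN /E' -twist_exponentN oppnE.
exact: cox_E_y.
Qed.

Let E_H i j : E i * H j = H j * E i.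
Proof. exact: cox_E_H. Qed.

Let E'_H i j : E' i * H j = H j * E' i.
Proof. by rewrite /E' -twist_exponentN; exact: cox_E_H. Qed.

Let E_E i j : E i * E j = E j * E i.
Proof. by apply: pr_hexp_commute; exact: cox_Z_comm. Qed.

Let EE'1 i : E i * E' i = 1.
Proof. by rewrite -rmorphM (hexpVr (Z i)) rmorph1. Qed.

Let E'E1 i : E' i * E i = 1.
Proof. by rewrite -rmorphM (hexpVl (Z i)) rmorph1. Qed.

Let E_E' i j : E i * E' j = E' j * E i.
Proof. exact: comm_inverse (EE'1 j) (E'E1 j) (E_E i j). Qed.

Let E'_E' i j : E' i * E' j = E' j * E' i.
Proof. exact: comm_inverse (EE'1 j) (E'E1 j) (esym (E_E' j i)). Qed.

Let c_eq i j : c i j = (d j)%:R * n i j - (d i)%:R * n j i + c' i j.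
Proof. by rewrite n_eq subrK. Qed.

(** The scalar condition s w = v s' of [morph_ef]. *)
Let scalar_ef i j :
  qpow (- c i j) * qpow (- ((d i)%:R * n j i)) =
  qpow (- ((d j)%:R * n i j)) * qpow (- c' i j).
Proof. by rewrite -!qpowD c_eq; congr qpow; ring. Qed.

(** The condition t w = t' v of the Serre relations. It serves both the e_i and the f_i, because
    e^(-hZ_i) has on Y_j the factor that e^(hZ_i) has on X_j. *)
Let scalar_serre i j :
  qpow (c i j) * qpow ((d i)%:R * n j i) = qpow (c' i j) * qpow ((d j)%:R * n i j).
Proof. by rewrite -!qpowD c_eq; congr qpow; ring. Qed.

Let serre_coef (c0 : 'M[K]_l) i j r : fps K :=
  (-1) ^+ r * qpow (c0 i j) ^+ r * qbinom (q_ K d i) (serre_exp a i j) r.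

Let g : {rmorphism F -> P} := pr S \o twist a d n.

Let gZ : scalable g.
Proof. by move=> e f; rewrite /= twistZ prZ. Qed.

Let gH i : g (genH K i) = H i. Proof. by rewrite /= twistH. Qed.
Let gx i : g (genx K i) = X i * E i. Proof. by rewrite /= twistx rmorphM. Qed.
Let gy i : g (geny K i) = E' i * Y i. Proof. by rewrite /= twisty rmorphM. Qed.

Lemma twist_cox_rel r : cox_rel a d c r -> pr S (twist a d n r) = 0.
Proof.
rewrite -[pr S _]/(g r); case=> {r} [i j|i j|i j|i j|i j ij|i j ij].
- by apply/morph_commutator; rewrite !gH; exact: cox_H_comm.
- have := cox_H_x a d c' i j; rewrite [fpsC _]rmorph_int => HX.
  have := morph_weight_mulr gZ (gH i) (gx j) HX (E_H j i).
  exact.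
- have := cox_H_y a d c' i j; rewrite [fpsC _]rmorphN /= [fpsC _]rmorph_int => HY.
  rewrite -[_ *: geny K j]opprK -scaleNr.
  have := morph_weight_mull gZ (gH i) (gy j) HY (E'_H j i).
  exact.
- have XY := pr_ef_rel (cox_ef a d c' i j).
  have := @morph_ef _ _ _ _ _ gZ _ _ _ _ _ _ _ _ _ _ _ _ _ (gx i) (gy j)
    (E_y i j) (E'_y j j) (E'_x j i) (E_E' i j) (scalar_ef i j) XY.
  apply; rewrite /= twistZ twist_Kfrac.
  (* For i = j the factors q^(-d_i n_ii) and q^(d_i n_ii) cancel and [E i * E' i] is 1; otherwise
     both sides vanish. *)
  case: eqP => [<-|_]; last first.
    rewrite scale0r rmorph0 mul0r scaler0; reflexivity.
  rewrite EE'1 -qpowD addNr qpow0 mulr1 scale1r; reflexivity.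
- have XX := @pr_word_rel _ _ S (serre_coef c' i j) _ _ _ (cox_serre_e a d c' ij).
  have := morph_serre_x gZ (gx i) (gx j) (E_x i i) (E_x i j) (E_x j i) (E_E i j)
    (scalar_serre i j) XX.
  exact.
- have YY := @pr_word_rel _ _ S (serre_coef c' i j) _ _ _ (cox_serre_f a d c' ij).
  have := morph_serre_y gZ (gy i) (gy j) (E'_y i i) (E'_y j j) (E'_y i j) (E'_y j i)
    (E'_E' i j) (scalar_serre i j) YY.
  exact.
Qed.

End TwistHom.

(** * The induced isomorphism *)

Section Induced.
Variables (K : comNzRingType) (A B : algType K).
Variables (S : fps A -> Prop) (S' : fps B -> Prop).
Variable T : {rmorphism fps A -> fps B}.
Hypotheses (TZ : scalable T) (TS : forall r, S r -> pr S' (T r) = 0).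

(** The choice of representative is immaterial by [inducedE], as T carries one ideal of relations
    into the other. *)
Definition induced (x : presented S) : presented S' := pr S' (T (repr x)).

Lemma inducedE x : induced (pr S x) = pr S' (T x).
Proof.
apply/pr_eq; rewrite -rmorphB; apply: (rel_ideal_morph TZ) => [r Sr|].
  by rewrite -[T r]subr0; apply/pr_eq; rewrite (TS Sr) rmorph0.
by apply/pr_eq; exact: prK.
Qed.

Fact induced_zmod : zmod_morphism induced.
Proof.
move=> x y; have [[x' ->] [y' ->]] := (pr_surj x, pr_surj y).
by rewrite -rmorphB !inducedE !rmorphB.
Qed.

HB.instance Definition _ :=
  GRing.isZmodMorphism.Build (presented S) (presented S') induced induced_zmod.

Fact induced_monoid : monoid_morphism induced.
Proof.
split=> [|x y]; first by rewrite -(rmorph1 (pr S)) inducedE !rmorph1.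
have [[x' ->] [y' ->]] := (pr_surj x, pr_surj y).
by rewrite -rmorphM !inducedE !rmorphM.
Qed.

HB.instance Definition _ :=
  GRing.isMonoidMorphism.Build (presented S) (presented S') induced induced_monoid.

Lemma induced_morphism : exists psi : {rmorphism presented S -> presented S'},
  scalable psi /\ forall x, psi (pr S x) = pr S' (T x).
Proof.
exists induced; split; last exact: inducedE.
by move=> c x; have [x' ->] := pr_surj x; rewrite /= -prZ !inducedE TZ prZ.
Qed.

End Induced.

(** * The isomorphism for an invertible Cartan matrix *)

Section Isomorphism.
Variables (K : numFieldType) (l : nat) (a : 'M[int]_l) (d : 'I_l -> nat).
Hypothesis a_unit : map_mx intr a \in (unitmx : pred 'M[K]_l).
Variables (c n : 'M[K]_l).
Hypothesis n_eq : forall i j, (d j)%:R * n i j - (d i)%:R * n j i = c i j.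

Lemma std_relE : @std_rel K l a d = cox_rel a d 0.
Proof.
have q0 (e : K) i j : e = (0 : 'M[K]_l) i j -> qpow e = 1.
  by rewrite mxE => ->; exact: qpow0.
apply/funext => r; apply/propext; split; case=> {r} [i j|i j|i j|i j|i j ij|i j ij].
- exact: cox_HH.
- exact: cox_He.
- exact: cox_Hf.
- have := cox_ef a d (0 : 'M[K]_l) i j.
  by rewrite (_ : qpow _ = 1) ?scale1r // mxE oppr0 qpow0.
- have := @cox_serre_e _ _ a d (0 : 'M[K]_l) _ _ ij.
  by rewrite (_ : qpow _ = 1) // mxE qpow0.
- have := @cox_serre_f _ _ a d (0 : 'M[K]_l) _ _ ij.
  by rewrite (_ : qpow _ = 1) // mxE qpow0.
- exact: std_HH.
- exact: std_HX.
- exact: std_HY.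
- rewrite (_ : qpow _ = 1) ?scale1r; last by rewrite mxE oppr0 qpow0.
  exact: std_XY.
- rewrite (_ : qpow _ = 1); last by rewrite mxE qpow0.
  exact: std_serreX.
- rewrite (_ : qpow _ = 1); last by rewrite mxE qpow0.
  exact: std_serreY.
Qed.

Lemma twist_to_std r : cox_rel a d c r -> pr (std_rel a d) (twist a d n r) = 0.
Proof.
rewrite std_relE; apply: (twist_cox_rel a_unit) => i j.
by rewrite n_eq mxE subr0.
Qed.

(** The equations for - n have right-hand side - c = 0 - c, which is the shift leading from 0 to
    c. *)
Lemma twist_from_std r : std_rel a d r -> pr (cox_rel a d c) (twist a d (- n) r) = 0.
Proof.
rewrite std_relE; apply: (twist_cox_rel a_unit) => i j.
by rewrite !mxE !mulrN -opprD n_eq add0r.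
Qed.

Lemma Uh_H_comm i j : pr (std_rel a d) (genH K i) * pr (std_rel a d) (genH K j) =
  pr (std_rel a d) (genH K j) * pr (std_rel a d) (genH K i).
Proof. by rewrite std_relE; exact: cox_H_comm. Qed.

(** The H_j commute in the quantum group, so the product merges into the single exponential used by
    the twist. *)
Lemma Uh_L_prod (v : 'I_l -> K) :
  \prod_p @Uh_L K l a d p (v p) = pr (std_rel a d) (hexp (\sum_p v p *: Y0 K a d p)).
Proof.
symmetry; apply: pr_hexp_sum => j k.
have YE p : v p *: Y0 K a d p =
    \sum_i (v p * ((d p)%:R * invmx (map_mx intr a : 'M[K]_l) p i)) *: H0 K i.
  by rewrite /Y0 scaler_sumr; apply: eq_bigr => i _; rewrite scalerA.
by rewrite !YE; apply: pr_comb_comm => p q; exact: Uh_H_comm.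
Qed.

Theorem twist_isomorphism :
  exists psi : {rmorphism Uhs a d c -> Uh K a d},
    [/\ scalable psi,
        bijective psi,
        forall i, psi (Uhs_e i) = Uh_Xp i * \prod_(p < l) Uh_L p (n i p),
        forall i, psi (Uhs_f i) = (\prod_(p < l) Uh_L p (- n i p)) * Uh_Xm i
      & forall i, psi (Uhs_H i) = Uh_H i].
Proof.
have [psi [psiZ psiE]] := induced_morphism (@twistZ _ _ a d n) twist_to_std.
have [psi' [_ psi'E]] := induced_morphism (@twistZ _ _ a d (- n)) twist_from_std.
have twistNK : cancel (twist a d (- n)) (twist a d n).
  by have := twistK a d (- n); rewrite opprK.
exists psi; split.
- exact: psiZ.
(* The twists by n and - n are inverse on the free algebra, hence so are the induced maps. *)
- exists psi' => x; have [y ->] := pr_surj x.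
    by rewrite psiE psi'E /= twistK.
  by rewrite psi'E psiE /= twistNK.
- move=> i; rewrite Uh_L_prod; apply: etrans (psiE _) _.
  by rewrite /= twistx rmorphM.
- move=> i; rewrite Uh_L_prod; apply: etrans (psiE _) _.
  have <- : - twist_exponent a d n i = \sum_p (- n i p) *: Y0 K a d p.
    by rewrite -sumrN; apply: eq_bigr => p _; rewrite scaleNr.
  by rewrite /= twisty rmorphM.
- by move=> i; apply: etrans (psiE _) _; rewrite /= twistH.
Qed.

End Isomorphism.

(** * Invertibility of the Cartan matrix *)

Section AdjointMatrix.
Variables (K : fieldType) (g : lieAlg K).
Implicit Types x y z : g.

HB.instance Definition _ x :=
  GRing.isLinear.Build K g g *:%R (@bracket K g x) (bracket_linearr x).

Lemma bracketDl y : {morph (@bracket K g)^~ y : x z / x + z}.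
Proof. by move=> x z; have := bracket_linearl y 1 x z; rewrite !scale1r. Qed.

Lemma bracket0l y : bracket 0 y = 0.
Proof. by apply: (addrI (bracket 0 y)); rewrite -bracketDl !addr0. Qed.

Lemma bracketZl c x y : bracket (c *: x) y = c *: bracket x y.
Proof. by have := bracket_linearl y c x 0; rewrite !addr0 bracket0l addr0. Qed.

Lemma bracket_anti x y : bracket x y = - bracket y x.
Proof.
apply/eqP; rewrite -addr_eq0; apply/eqP; have := bracket_alt (x + y).
by rewrite bracketDl !raddfD /= !bracket_alt add0r addr0.
Qed.

Local Notation coords := (rVof (vbasis {:g})).

Let coordsK : cancel coords (vecof (vbasis {:g})) := rVofK (vbasisP _).

(** Vectors of g are rows, so composition of operators reverses products. *)
Definition ad_mx x : 'M[K]_(\dim {:g}) :=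
  lin1_mx (coords \o bracket x \o vecof (vbasis {:g})).

Lemma mul_ad_mx x y : coords y *m ad_mx x = coords (bracket x y).
Proof. by rewrite /ad_mx mul_rV_lin1 /= coordsK. Qed.

Lemma eq_mul_coords (A B : 'M[K]_(\dim {:g})) :
  (forall y : g, coords y *m A = coords y *m B) -> A = B.
Proof.
move=> AB; apply/row_matrixP => i; rewrite !rowE.
by rewrite -[delta_mx 0 i](vecofK (vbasisP {:g})).
Qed.

Fact ad_mx_linear : linear ad_mx.
Proof.
move=> c x y; apply: eq_mul_coords => z.
rewrite mulmxDr -scalemxAr !mul_ad_mx bracketDl bracketZl.
by rewrite linearD linearZ.
Qed.

HB.instance Definition _ :=
  GRing.isLinear.Build K g 'M[K]_(\dim {:g}) *:%R ad_mx ad_mx_linear.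

(** The Jacobi identity, with products reversed by the row convention. *)
Lemma ad_mx_bracket x y :
  ad_mx (bracket x y) = ad_mx y *m ad_mx x - ad_mx x *m ad_mx y.
Proof.
apply: eq_mul_coords => z; rewrite mulmxBr !mulmxA !mul_ad_mx -raddfB /=; congr coords.
have /eqP := bracket_jacobi x y z; rewrite -addrA addr_eq0 => /eqP ->.
rewrite (bracket_anti z x) linearN /= (bracket_anti z (bracket x y)).
by rewrite !opprD !opprK addrAC addrN add0r.
Qed.

Definition killing x y : K := \tr (ad_mx x *m ad_mx y).

(** Cyclicity of the trace: tr(YXZ) = tr(XZY) for the adjoint matrices X, Y, Z. *)
Lemma killing_inv x y z : killing (bracket x y) z = killing x (bracket y z).
Proof.
rewrite /killing !ad_mx_bracket mulmxBl mulmxBr !raddfB /=; congr (_ - _).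
  by rewrite mulmxA [LHS]mxtrace_mulC mulmxA [LHS]mxtrace_mulC mulmxA.
by rewrite mulmxA.
Qed.

Lemma ad_mx_eq0 x : ad_mx x = 0 -> forall y, bracket x y = 0.
Proof.
move=> x0 y; apply: (can_inj coordsK).
by rewrite -mul_ad_mx x0 mulmx0 linear0.
Qed.

Lemma ad_diagonalizable_mx x : ad_diagonalizable x -> diagonalizable (ad_mx x).
Proof.
case=> e [eB eP].
have size_e : size e = \dim {:g} by rewrite (size_basis (X := in_tuple e) eB).
pose P := \matrix_(i < \dim {:g}) coords e`_i.
have uP : P \in unitmx.
  (* The rows of P are the coordinates of an eigenbasis, and every row vector is the coordinate row
     of some vector, which expands in that basis. *)
  rewrite -row_full_unit -sub1mx; apply/row_subP => i; rewrite row1.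
  rewrite -[delta_mx 0 i](vecofK (vbasisP {:g})).
  set v := vecof _ _.
  rewrite [v](coord_basis (X := in_tuple e) eB (memvf v)) linear_sum summx_sub // => k _.
  rewrite linearZ scalemx_sub //.
  have lt_k : (k < \dim {:g})%N by rewrite -size_e.
  have Pk : row (Ordinal lt_k) P = coords e`_k by rewrite rowK.
  by rewrite /= -Pk row_sub.
have /choice[c cP] (i : 'I_(\dim {:g})) : exists c, bracket x e`_i = c *: e`_i.
  by apply: eP; rewrite mem_nth // size_e.
exists P => //; apply/diagonalizable_forPex; exists (\row_i c i); apply/simmxP => //.
apply/row_matrixP => i; rewrite !row_mul rowK mul_ad_mx cP linearZ /=.
by rewrite row_diag_mx mxE -scalemxAl -rowE rowK.
Qed.

End AdjointMatrix.

(** * Weights of the adjoint representation and the Killing form *)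

Section Weights.
Variables (K : numClosedFieldType) (g : lieAlg K) (l : nat) (D : root_datum g l).
Local Notation h := (cartan D).
Local Notation coords := (rVof (vbasis {:g})).

Lemma ad_mx_commute (s t : subvs_of h) :
  ad_mx (vsval s) *m ad_mx (vsval t) = ad_mx (vsval t) *m ad_mx (vsval s).
Proof.
have [hab _ _] := cartanP D.
apply/eqP; rewrite -subr_eq0 -ad_mx_bracket hab ?subvsP //.
by rewrite raddf0.
Qed.

(** The weight decomposition of the adjoint representation, the beta_j being its weights with
    multiplicity, zero included: commuting diagonalizable matrices are simultaneously
    diagonalizable. *)
Lemma cartan_codiagonalizable :
  exists2 P, P \in unitmx & exists beta : 'I_(\dim {:g}) -> dual h,
    forall s : subvs_of h, P *m ad_mx (vsval s) = diag_mx (\row_j (beta j s : K)) *m P.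
Proof.
have [_ _ hdiag] := cartanP D.
pose As := [seq ad_mx (vsval s) | s <- vbasis {: subvs_of h}].
have [P uP /allP PD] : codiagonalizable As.
  apply/codiagonalizableP; split=> [_ _ /mapP[s _ ->] /mapP[t _ ->]|_ /mapP[s _ ->]].
    exact: ad_mx_commute.
  by apply: ad_diagonalizable_mx; apply: hdiag; exact: subvsP.
exists P => //.
(* The weights are the diagonal entries of the conjugated matrix, which depend linearly on s. *)
pose b j (s : subvs_of h) : K^o := (P *m ad_mx (vsval s) *m invmx P) j j.
have b_lin j : linear (b j).
  move=> c s t; rewrite /b (linearP vsval) (linearP (@ad_mx K g)).
  by rewrite mulmxDr mulmxDl -scalemxAr -scalemxAl !mxE.
pose bl j : {linear subvs_of h -> K^o} :=
  HB.pack (b j) (GRing.isLinear.Build _ _ _ _ (b j) (b_lin j)).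
exists (fun j => linfun (bl j)).
(* Off-diagonal entries vanish on a basis of the Cartan subalgebra, hence on all of it by
   linearity. *)
have Pdiag i j (s : subvs_of h) : i != j -> (P *m ad_mx (vsval s) *m invmx P) i j = 0.
  move=> ij; pose X := vbasis {: subvs_of h}.
  have -> : ad_mx (vsval s) = \sum_k coord X k s *: ad_mx (vsval X`_k).
    rewrite {1}(coord_basis (vbasisP {: subvs_of h}) (memvf s)) !linear_sum /=.
    by apply: eq_bigr => k _; rewrite !linearZ.
  rewrite mulmx_sumr mulmx_suml summxE big1 // => k _.
  rewrite -scalemxAr -scalemxAl mxE.
  have /PD/diagonalizable_forP -> : ad_mx (vsval X`_k) \in As.
  - by apply: map_f; rewrite mem_nth ?size_tuple.
  - by rewrite mulr0.
  - exact: uP.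
  - exact: ij.
move=> s; rewrite -[LHS](mulmxKV uP); congr (_ *m P).
apply/matrixP => i j; rewrite [RHS]mxE [X in X *+ _]mxE; case: (eqVneq i j) => [<-|ij].
  by rewrite mulr1n lfunE.
by rewrite mulr0n; exact: Pdiag.
Qed.

Variable a : 'M[int]_l.
Hypothesis aP : is_cartan_matrix D a.
Local Notation alpha := (tnth (simple_root D)).

(** Row j of P is a common eigenvector of weight beta_j, nonzero because P is invertible. *)
Lemma weight_coords (P : 'M[K]_(\dim {:g})) (beta : 'I_(\dim {:g}) -> dual h) :
  P \in unitmx ->
  (forall s : subvs_of h, P *m ad_mx (vsval s) = diag_mx (\row_j (beta j s : K)) *m P) ->
  forall j, beta j = 0 \/ is_root (beta j).
Proof.
move=> uP Pb j; have [->|b_neq0] := eqVneq (beta j) 0; [by left | right].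
pose w := vecof (vbasis {:g}) (row j P).
have wE : coords w = row j P by exact: (vecofK (vbasisP {:g})).
split; first exact/eqP.
exists w => [w0|s].
  have : row j P = 0 by rewrite -wE w0 linear0.
  move=> /(congr1 (fun v => v *m invmx P)); rewrite -row_mul mulmxV // mul0mx.
  by move=> /rowP/(_ j)/eqP; rewrite !mxE eqxx oner_eq0.
apply: (can_inj (rVofK (vbasisP {:g}))).
rewrite -mul_ad_mx wE -row_mul Pb row_mul row_diag_mx linearZ /= wE mxE.
by rewrite -scalemxAl -rowE.
Qed.

(** A root is an integral combination of simple roots, whose values at coroots are the integers
    a_ij. *)
Lemma root_real beta i : beta = 0 \/ is_root beta -> (beta (coroot D i) : K) \is Num.real.
Proof.
have sumE (m : 'I_l -> nat) :
    ((\sum_j alpha j *+ m j) (coroot D i) : K) = \sum_j ((a i j)%:~R : K) *+ m j.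
  rewrite sum_lfunE; apply: eq_bigr => j _.
  by rewrite -scaler_nat scale_lfunE -aP scaler_nat.
have sum_real (m : 'I_l -> nat) : \sum_j ((a i j)%:~R : K) *+ m j \is Num.real.
  by apply: rpred_sum => j _; rewrite rpredMn // realz.
case=> [->|broot]; first by rewrite zero_lfunE; exact: real0.
have [_ _ /(_ _ broot)[m [] ->]] := simple_rootP D.
  by rewrite sumE.
by rewrite opp_lfunE sumE rpredN.
Qed.

Lemma killing_weights (P : 'M[K]_(\dim {:g})) (beta : 'I_(\dim {:g}) -> dual h) :
  P \in unitmx ->
  (forall s : subvs_of h, P *m ad_mx (vsval s) = diag_mx (\row_j (beta j s : K)) *m P) ->
  forall s t : subvs_of h,
    killing (vsval s) (vsval t) = \sum_j (beta j s : K) * (beta j t : K).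
Proof.
move=> uP Pb s t; rewrite /killing -[_ *m _](mulKmx uP) mxtrace_mulC.
rewrite mulmxA Pb -(mulmxA _ P) Pb -!mulmxA mulmxV // mulmx1 mulmx_diag mxtrace_diag.
by apply: eq_bigr => j _; rewrite !mxE.
Qed.

(** The value is a sum of squares of real numbers. If it is 0, all weights vanish at the coroot t,
    so ad t = 0; then [t, x] = 2x gives x = 0 and t = [x, y] = 0, against alpha_i(t) = 2. *)
Lemma killing_coroot_neq0 i : killing (vsval (coroot D i)) (vsval (coroot D i)) != 0.
Proof.
have [P uP [beta Pb]] := cartan_codiagonalizable.
have bP := weight_coords uP Pb.
have [t2 [x [y [xw _ xy]]]] := corootP D i.
rewrite (killing_weights uP Pb); apply/eqP => sum0.
have b0 j : (beta j (coroot D i) : K) = 0.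
  have b_ge0 k : true -> 0 <= (beta k (coroot D i) : K) * (beta k (coroot D i) : K).
    by move=> _; rewrite -expr2 real_exprn_even_ge0 //; apply: root_real.
  have /(_ j isT)/eqP := psumr_eq0P b_ge0 sum0.
  by rewrite mulf_eq0 orbb => /eqP.
have ad0 : ad_mx (vsval (coroot D i)) = 0.
  rewrite -[ad_mx _](mulKmx uP) Pb.
  have -> : \row_j (beta j (coroot D i) : K) = 0 by apply/rowP => j; rewrite !mxE b0.
  by rewrite linear0 mul0mx mulmx0.
have x0 : x = 0.
  have := xw (coroot D i); rewrite (ad_mx_eq0 ad0) t2 => /esym/eqP.
  by rewrite scaler_eq0 pnatr_eq0 => /eqP.
move: xy; rewrite x0 bracket0l -(linear0 (@vsval _ _ h)) => /esym/subvs_inj t0.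
by move/eqP: t2; rewrite t0 linear0 eq_sym pnatr_eq0.
Qed.

(** Invariance gives kappa([x, y], s) = kappa(x, [y, s]) = kappa(x, y) alpha_i(s), as y has weight -
    alpha_i. The value at the coroot itself shows that kappa(x, y) is nonzero. *)
Lemma killing_coroot i : exists2 k : K, k != 0 &
  forall s : subvs_of h, killing (vsval (coroot D i)) (vsval s) = k * (alpha i s : K).
Proof.
have [t2 [x [y [_ yw xy]]]] := corootP D i.
have kE (s : subvs_of h) :
    killing (vsval (coroot D i)) (vsval s) = killing x y * (alpha i s : K).
  rewrite -xy killing_inv bracket_anti yw opp_lfunE scaleNr opprK.
  by rewrite /killing linearZ -scalemxAr linearZ mulrC.
exists (killing x y) => //; apply/eqP => k0.
by have := killing_coroot_neq0 i; rewrite kE k0 mul0r eqxx.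
Qed.

Theorem cartan_matrix_unit : map_mx intr a \in (unitmx : pred 'M[K]_l).
Proof.
rewrite -row_free_unit; apply: inj_row_free => v va0.
have [P uP [beta Pb]] := cartan_codiagonalizable.
(* For v in the left kernel of the Cartan matrix, alpha_j(s) is the j-th entry of v a, hence 0. *)
pose s := \sum_i v 0 i *: coroot D i.
have alpha_s j : (alpha j s : K) = 0.
  rewrite linear_sum; have /rowP/(_ j) := va0; rewrite !mxE => va0j.
  by rewrite -[RHS]va0j; apply: eq_bigr => i _; rewrite linearZ mxE -aP.
(* A weight is 0 or, up to sign, a combination of simple roots; so it kills s, whence kappa(s, t) =
   0 for all t below. *)
have beta_s j : (beta j s : K) = 0.
  have [->|broot] := weight_coords uP Pb j; first by rewrite zero_lfunE.
  have [_ _ /(_ _ broot)[m bm]] := simple_rootP D.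
  have sum0 : ((\sum_j alpha j *+ m j) s : K) = 0.
    rewrite sum_lfunE big1 // => k _.
    by rewrite -scaler_nat scale_lfunE alpha_s scaler0.
  by case: bm => ->; rewrite ?opp_lfunE sum0 ?oppr0.
have /choice[k kP] i : exists k : K, k != 0 /\
    forall s : subvs_of h, killing (vsval (coroot D i)) (vsval s) = k * (alpha i s : K).
  by have [k k0 kE] := killing_coroot i; exists k.
(* Expanding kappa(s, t) = 0 over the coroots gives a linear relation between the simple roots,
   which are independent. *)
have vk0 : \sum_i (v 0 i * k i) *: (simple_root D)`_i = 0.
  apply/lfunP => t; rewrite sum_lfunE zero_lfunE.
  transitivity (killing (vsval s) (vsval t)); last first.
    by rewrite (killing_weights uP Pb) big1 // => j _; rewrite beta_s mul0r.
  rewrite /killing /s !linear_sum /= mulmx_suml linear_sum; apply: eq_bigr => i _.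
  rewrite !linearZ /= -scalemxAl linearZ /= scale_lfunE -tnth_nth.
  by have [_ kE] := kP i; rewrite -[\tr _]/(killing _ _) kE mulrA.
have [_ /basis_free/freeP alpha_free _] := simple_rootP D.
apply/rowP => i; rewrite mxE; have /eqP := alpha_free _ vk0 i.
by rewrite mulf_eq0 => /orP[/eqP //|k0]; have [/negP] := kP i.
Qed.

End Weights.

Theorem theorem3p2p4 (R : realType) (g : lieAlg R[i]) (l : nat)
    (D : root_datum g l) (a : 'M[int]_l) (d : 'I_l -> nat) (pi : 'S_l)
    (n : 'M[R[i]]_l) (c := coxeter_matrix D a d pi) :
  lie_simple g ->
  is_cartan_matrix D a ->
  (forall i, (0 < d i)%N) ->
  \big[gcdn/0%N]_(i < l) d i = 1%N ->
  (forall i j, (d i)%:Z * a i j = (d j)%:Z * a j i) ->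
  (forall i j, (d j)%:R * n i j - (d i)%:R * n j i = c i j) ->
  exists psi : {rmorphism Uhs a d c -> Uh R[i] a d},
    [/\ scalable psi,
        bijective psi,
        forall i, psi (Uhs_e i) = Uh_Xp i * \prod_(p < l) Uh_L p (n i p),
        forall i, psi (Uhs_f i) = (\prod_(p < l) Uh_L p (- n i p)) * Uh_Xm i
      & forall i, psi (Uhs_H i) = Uh_H i].
Proof.
move=> _ aP _ _ _ n_eq.
have := twist_isomorphism (cartan_matrix_unit aP) n_eq.
exact.
Qed.
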